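(* Assume $g$ satisfies A1, A2, A1* and A3w and suppose $u\in C^0(\Omega)$ is $g$-convex in the bounded domain $\Omega\subset\mathbb{R}^n$. Assume also: (i) $\Omega$ is $g$-convex with respect to some $y_0\in\mathbb{R}^n$, $z_0\in I(\Omega,y_0)$; (ii) $Tu(\Omega)\cup\{y_0\}$ is sub $g^*$-convex with respect to $g_0:=g(\cdot,y_0,z_0)$ in $\Omega$. Then the section $S=\{x\in\Omega: u(x)<g_0(x)\}$ is also $g$-convex with respect to $(y_0,z_0)$, while if $g_0$ is a $g$-support to $u$, the contact set $S_0=\{x\in\Omega:u(x)=g_0(x)\}$ is $g$-convex with respect to $(y_0,z_0)$.
   Context: Generating functions. $\Gamma\subset\mathbb{R}^n\times\mathbb{R}^n\times\mathbb{R}$ is a domain with points $(x,y,z)$ such that the sets $I(x,y)=\{z:(x,y,z)\in\Gamma\}$ are open intervals (possibly empty); $\Gamma_x=\{(y,z):(x,y,z)\in\Gamma\}$, $\Gamma_{y,z}=\{x:(x,y,z)\in\Gamma\}$. A generating function is $g\in C^2(\Gamma)$ with $g_z\neq0$; throughout it is normalised so that $g_z<0$. Subscripts denote partial derivatives. Conditions: A1: for each $x$, the map $(g_x,g)(x,\cdot,\cdot)$ is one-to-one on $\Gamma_x$. A2: $\det E\ne0$ in $\Gamma$, where $E=g_{x,y}-(g_z)^{-1}g_{x,z}\otimes g_y$. A1*: for all $(y,z)$, the map $Q(\cdot,y,z)=-\frac{g_y}{g_z}(\cdot,y,z)$ is one-to-one on $\Gamma_{y,z}$. Let $J(x,y)=g(x,y,I(x,y))$,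 $\Gamma^*=\{(x,y,u):u\in J(x,y)\}$. The dual generating function $g^*$ on $\Gamma^*$ is defined by $g(x,y,g^*(x,y,u))=u$, and $P(x,y,u)=g_x(x,y,g^*(x,y,u))$. Let $\mathcal{U}=\{(x,u,p): u=g(x,y,z),\ p=g_x(x,y,z)\text{ for some }(x,y,z)\in\Gamma\}$. Under A1, A2 there are $C^1$ maps $Y,Z$ on $\mathcal{U}$ with $g_x(x,Y,Z)=p$, $g(x,Y,Z)=u$. Put $A(x,u,p)=g_{xx}(x,Y(x,u,p),Z(x,u,p))$, assumed twice differentiable. A3w: $(D_{p_kp_l}A_{ij})\xi_i\xi_j\eta_k\eta_l\ge0$ on $\mathcal{U}$ for all $\xi,\eta\in\mathbb{R}^n$ with $\xi\cdot\eta=0$. Convexity. $I(\Omega,y_0)=\bigcap_{x\in\Omega}I(x,y_0)$, $J(x_0,S^* )=\bigcap_{y\in S^*}J(x_0,y)$. A function $u\in C^0(\Omega)$ is $g$-convex in $\Omega$ if for each $x_0\in\Omega$ there are $y_0\in\mathbb{R}^n$, $z_0\in I(\Omega,y_0)$ with $u(x_0)=g(x_0,y_0,z_0)$ and $u\ge g(\cdot,y_0,z_0)$ in $\Omega$; then $g(\cdot,y_0,z_0)$ is called a $g$-support to $u$ (at $x_0$). The $g$-normal mapping is $Tu(x_0)=\{y_0\in\mathbb{R}^n:\Omega\subset\Gamma_{y_0,z_0},\ u\ge g(\cdot,y_0,z_0)\text{ in }\Omega\}$ with $z_0=g^*(x_0,y_0,u(x_0))$, and $Tu(\Omega)=\bigcup_{x\in\Omega}Tu(x)$.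 A set $S\subset\mathbb{R}^n$ is $g$-convex with respect to $(y_0,z_0)$ (with $z_0\in I(S,y_0)$) if $Q(\cdot,y_0,z_0)(S)$ is convex. A set $S^*\subset\mathbb{R}^n$ is sub $g^*$-convex with respect to $(x_0,u_0)$, $u_0\in J(x_0,S^* )$, if the convex hull of $P(x_0,\cdot,u_0)(S^* )$ is contained in $P(x_0,\cdot,u_0)(\{y:(x_0,y,u_0)\in\Gamma^*\})$; it is sub $g^*$-convex with respect to a function $w$ in $\Omega$ if this holds with respect to $(x,w(x))$ for every $x\in\Omega$. *)

(* Defs.v *)
From HB Require Import structures.
From mathcomp Require Import all_boot all_order all_algebra.
From mathcomp Require Import all_classical all_reals all_analysis.
Import Order.TTheory GRing.Theory Num.Theory.
Import numFieldNormedType.Exports.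

Set Implicit Arguments.
Unset Strict Implicit.
Unset Printing Implicit Defensive.

Local Open Scope classical_set_scope.
Local Open Scope ring_scope.

Definition is_domain (T : topologicalType) (D : set T) : Prop :=
  [/\ D !=set0, open D & connected D].

(* Regularity on an open set D: since only the values of f near points of D
   matter, a function defined on D is represented by any total extension. *)
Definition C1_on (R : realType) (V W : normedModType R) (D : set V)
    (f : V -> W) : Prop :=
  forall p, D p ->
    differentiable f p /\ forall v, {for p, continuous ('D_v f)}.

Definition C2_on (R : realType) (V W : normedModType R) (D : set V)
    (f : V -> W) : Prop :=
  C1_on D f /\ forall v, C1_on D ('D_v f).

Definition twice_differentiable_on (R : realType) (V W : normedModType R)
    (D : set V) (f : V -> W) : Prop :=
  forall p, D p ->
    differentiable f p /\ forall v, differentiable ('D_v f) p.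

Definition convex_hull (R : realType) (V : lmodType R) (S : set V) : set V :=
  \bigcap_(C in [set C : set V | convex_set C /\ S `<=` C]) C.

(* Points (x, y, z) of the domain of g, and points (x, u, p). *)
Notation xyz R n := ('rV[R]_n * 'rV[R]_n * R)%type.
Notation xup R n := ('rV[R]_n * R * 'rV[R]_n)%type.

(* Coordinate directions; partial derivatives are derivatives along these. *)
Definition dx (R : realType) (n : nat) (i : 'I_n) : xyz R n :=
  (delta_mx 0 i, 0, 0).
Definition dy (R : realType) (n : nat) (i : 'I_n) : xyz R n :=
  (0, delta_mx 0 i, 0).
Definition dz (R : realType) (n : nat) : xyz R n := (0, 0, 1).
Definition dp (R : realType) (n : nat) (k : 'I_n) : xup R n :=
  (0, 0, delta_mx 0 k).

Definition g_x (R : realType) (n : nat) (g : xyz R n -> R) (q : xyz R n) :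
    'rV[R]_n :=
  \row_i 'D_(dx R i) g q.
Definition g_y (R : realType) (n : nat) (g : xyz R n -> R) (q : xyz R n) :
    'rV[R]_n :=
  \row_i 'D_(dy R i) g q.
Definition g_z (R : realType) (n : nat) (g : xyz R n -> R) (q : xyz R n) : R :=
  'D_(dz R n) g q.
Definition g_xx (R : realType) (n : nat) (g : xyz R n -> R) (q : xyz R n) :
    'M[R]_n :=
  \matrix_(i, j) 'D_(dx R j) ('D_(dx R i) g) q.
Definition g_xy (R : realType) (n : nat) (g : xyz R n -> R) (q : xyz R n) :
    'M[R]_n :=
  \matrix_(i, j) 'D_(dy R j) ('D_(dx R i) g) q.
Definition g_xz (R : realType) (n : nat) (g : xyz R n -> R) (q : xyz R n) :
    'rV[R]_n :=
  \row_i 'D_(dz R n) ('D_(dx R i) g) q.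

Definition Iint (R : realType) (n : nat) (G : set (xyz R n))
    (x y : 'rV[R]_n) : set R :=
  [set z | G (x, y, z)].

Definition generating_function (R : realType) (n : nat) (G : set (xyz R n))
    (g : xyz R n -> R) : Prop :=
  [/\ is_domain G,
      forall x y, open (Iint G x y) /\ is_interval (Iint G x y),
      C2_on G g
    & forall q, G q -> g_z g q < 0].

Definition A1 (R : realType) (n : nat) (G : set (xyz R n))
    (g : xyz R n -> R) : Prop :=
  forall x : 'rV[R]_n,
    set_inj [set yz : 'rV[R]_n * R | G (x, yz.1, yz.2)]
            (fun yz => (g_x g (x, yz.1, yz.2), g (x, yz.1, yz.2))).

(* The tensor product of row vectors a, b is the matrix (a_i b_j). *)
Definition Emx (R : realType) (n : nat) (g : xyz R n -> R) (q : xyz R n) :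
    'M[R]_n :=
  g_xy g q - (g_z g q)^-1 *: ((g_xz g q)^T *m g_y g q).

Definition A2 (R : realType) (n : nat) (G : set (xyz R n))
    (g : xyz R n -> R) : Prop :=
  forall q, G q -> \det (Emx g q) != 0.

Definition Q (R : realType) (n : nat) (g : xyz R n -> R) (q : xyz R n) :
    'rV[R]_n :=
  - ((g_z g q)^-1 *: g_y g q).

Definition A1star (R : realType) (n : nat) (G : set (xyz R n))
    (g : xyz R n -> R) : Prop :=
  forall (y : 'rV[R]_n) (z : R),
    set_inj [set x : 'rV[R]_n | G (x, y, z)] (fun x => Q g (x, y, z)).

Definition Jint (R : realType) (n : nat) (G : set (xyz R n))
    (g : xyz R n -> R) (x y : 'rV[R]_n) : set R :=
  (fun z => g (x, y, z)) @` Iint G x y.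

Definition Gamma_star (R : realType) (n : nat) (G : set (xyz R n))
    (g : xyz R n -> R) : set (xyz R n) :=
  [set q | Jint G g q.1.1 q.1.2 q.2].

(* The solution z of g (x, y, z) = u; it exists exactly on Gamma_star, where
   it is unique because g_z < 0, and takes an arbitrary value elsewhere. *)
Definition gstar (R : realType) (n : nat) (G : set (xyz R n))
    (g : xyz R n -> R) (x y : 'rV[R]_n) (u : R) : R :=
  xget 0 [set z | G (x, y, z) /\ g (x, y, z) = u].

Definition P (R : realType) (n : nat) (G : set (xyz R n))
    (g : xyz R n -> R) (x y : 'rV[R]_n) (u : R) : 'rV[R]_n :=
  g_x g (x, y, gstar G g x y u).

Definition U (R : realType) (n : nat) (G : set (xyz R n))
    (g : xyz R n -> R) : set (xup R n) :=
  [set w | exists y z,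
     [/\ G (w.1.1, y, z), w.1.2 = g (w.1.1, y, z)
       & w.2 = g_x g (w.1.1, y, z)]].

(* The pair (Y, Z) (x, u, p); it exists exactly on U, where it is unique
   under A1, and takes an arbitrary value elsewhere. *)
Definition YZ (R : realType) (n : nat) (G : set (xyz R n))
    (g : xyz R n -> R) (w : xup R n) : 'rV[R]_n * R :=
  xget (0, 0) [set yz | [/\ G (w.1.1, yz.1, yz.2),
                            g_x g (w.1.1, yz.1, yz.2) = w.2
                          & g (w.1.1, yz.1, yz.2) = w.1.2]].

Definition Amx (R : realType) (n : nat) (G : set (xyz R n))
    (g : xyz R n -> R) (w : xup R n) : 'M[R]_n :=
  g_xx g (w.1.1, (YZ G g w).1, (YZ G g w).2).

Definition A3w (R : realType) (n : nat) (G : set (xyz R n))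
    (g : xyz R n -> R) : Prop :=
  forall w, U G g w -> forall xi eta : 'rV[R]_n,
    \sum_i xi 0 i * eta 0 i = 0 ->
    0 <= \sum_i \sum_j \sum_k \sum_l
           'D_(dp R k) ('D_(dp R l) (fun w' => Amx G g w' i j)) w
             * xi 0 i * xi 0 j * eta 0 k * eta 0 l.

Definition IS (R : realType) (n : nat) (G : set (xyz R n))
    (S : set 'rV[R]_n) (y : 'rV[R]_n) : set R :=
  \bigcap_(x in S) Iint G x y.

Definition JS (R : realType) (n : nat) (G : set (xyz R n))
    (g : xyz R n -> R) (x : 'rV[R]_n) (S' : set 'rV[R]_n) : set R :=
  \bigcap_(y in S') Jint G g x y.

(* g (., y0, z0) is a g-support to u at x0. *)
Definition g_support_at (R : realType) (n : nat) (G : set (xyz R n))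
    (g : xyz R n -> R) (Om : set 'rV[R]_n) (u : 'rV[R]_n -> R)
    (y0 : 'rV[R]_n) (z0 : R) (x0 : 'rV[R]_n) : Prop :=
  [/\ IS G Om y0 z0, u x0 = g (x0, y0, z0)
    & forall x, Om x -> g (x, y0, z0) <= u x].

Definition g_support (R : realType) (n : nat) (G : set (xyz R n))
    (g : xyz R n -> R) (Om : set 'rV[R]_n) (u : 'rV[R]_n -> R)
    (y0 : 'rV[R]_n) (z0 : R) : Prop :=
  exists2 x0, Om x0 & g_support_at G g Om u y0 z0 x0.

Definition g_convex_function (R : realType) (n : nat) (G : set (xyz R n))
    (g : xyz R n -> R) (Om : set 'rV[R]_n) (u : 'rV[R]_n -> R) : Prop :=
  forall x0, Om x0 -> exists y0 z0, g_support_at G g Om u y0 z0 x0.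

(* Membership in Gamma_star says that g^* (x0, y0, u x0) is defined. *)
Definition Tu (R : realType) (n : nat) (G : set (xyz R n))
    (g : xyz R n -> R) (Om : set 'rV[R]_n) (u : 'rV[R]_n -> R)
    (x0 : 'rV[R]_n) : set 'rV[R]_n :=
  [set y0 | Gamma_star G g (x0, y0, u x0) /\
     let z0 := gstar G g x0 y0 (u x0) in
     Om `<=` [set x | G (x, y0, z0)] /\
     forall x, Om x -> g (x, y0, z0) <= u x].

Definition g_convex_set (R : realType) (n : nat) (G : set (xyz R n))
    (g : xyz R n -> R) (S : set 'rV[R]_n) (y0 : 'rV[R]_n) (z0 : R) : Prop :=
  IS G S y0 z0 /\ convex_set ((fun x => Q g (x, y0, z0)) @` S).

Definition sub_gstar_convex_at (R : realType) (n : nat) (G : set (xyz R n))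
    (g : xyz R n -> R) (S' : set 'rV[R]_n) (x0 : 'rV[R]_n) (u0 : R) : Prop :=
  JS G g x0 S' u0 /\
  convex_hull ((fun y => P G g x0 y u0) @` S') `<=`
    (fun y => P G g x0 y u0) @` [set y | Gamma_star G g (x0, y, u0)].

Definition sub_gstar_convex (R : realType) (n : nat) (G : set (xyz R n))
    (g : xyz R n -> R) (S' : set 'rV[R]_n) (w : 'rV[R]_n -> R)
    (Om : set 'rV[R]_n) : Prop :=
  forall x, Om x -> sub_gstar_convex_at G g S' x (w x).

(* Main.v *)
(** Both sets are intersections, over the g-supports g(., y1, z1) of u, of the
   sets where g(., y1, z1) lies below g(., y0, z0), so u may be replaced by one
   such support with y1 <> y0.  As g_z < 0, these are sublevel sets of the
   function H determined by g(x, y1, H(x)) = g(x, y0, z0), and it suffices that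
   H be quasiconvex along every curve c in Omega on which Q(., y0, z0) is affine.

   At an interior maximum of t |-> H(c(t)) + eps exp(M t), put z = H(c(t)) and
   h = g(., y1, z) - g(., y0, z0), and let eta be the gradient of h at a = c(t).
   A2 gives a direction w = (0, b, s) such that l := D_w g(., y0, z0) vanishes at
   a with gradient eta there.  Then l o c is an affine function times
   g_z(c, y0, z0), since l / g_z is an affine function of Q; the Hessian of h - l
   at a is A(a, u, p + eta) - A(a, u, p) - D_p A(a, u, p) eta, which A3w makes
   nonnegative on vectors orthogonal to eta; and h - l has zero gradient at a, so
   that only the first derivative of c enters the second-order expansion of h o c.
   The component of c' along eta is controlled by the first-order condition, and
   the second-order condition bounds M by a continuous function of t, which fails
   for M large.  The Hessian of l is found from g_xx = A(x, g, g_x), whose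
   derivatives in (y, z) exist although g is only C^2. *)

Require Import Defs.
From HB Require Import structures.
From mathcomp Require Import all_boot all_order all_algebra.
From mathcomp Require Import all_classical all_reals all_analysis.
From mathcomp Require Import ring lra.
Import Order.TTheory GRing.Theory Num.Theory.
Import numFieldNormedType.Exports.

Local Open Scope classical_set_scope.
Local Open Scope ring_scope.

Set Implicit Arguments.
Unset Strict Implicit.
Unset Printing Implicit Defensive.

(** * Second-order Taylor estimates *)

(** As [g] is only C^2, Q(., y0, z0) is only C^1, so the curve c has a first derivative but perhaps
    no second one, and h o c cannot be differentiated twice. All second-order information is
    therefore carried by expansions with remainder o(h^2), and the linear term in c(t + h) - c(t),
    whose second-order part is unknown, is traded for the exactly known values of l o c. A3w is not
    strict, so the second-order condition at a maximum of H o c alone is no contradiction. The term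
    eps exp(M t) gives the touching curve a slope m > 0. By the first-order condition the component
    of c' along eta is proportional to m, so every term of the second-order condition carries a
    factor m, except the value of the A3w form on the component of c' orthogonal to eta, which has a
    sign. Dividing by m leaves a bound on M that is independent of eps. *)

Lemma is_derive_line (R : realType) (V W : normedModType R) (f : V -> W)
    (p v : V) (r : R) :
  derivable f (p + r *: v) v ->
  is_derive r 1 (fun s => f (p + s *: v)) ('D_v f (p + r *: v)).
Proof.
move=> df.
have E : (fun h : R => h^-1 *: (((fun s => f (p + s *: v)) \o shift r) (h *: 1)
            - f (p + r *: v))) =
         (fun h => h^-1 *: ((f \o shift (p + r *: v)) (h *: v)
            - f (p + r *: v))).
  apply/funext => h /=; congr (_ *: (f _ - _)).
  by rewrite [h *: 1]mulr1 scalerDl addrCA.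
by split; rewrite ?/derivable ?/derive E.
Qed.

Lemma is_derive_sum_fun (R : realType) (V W : normedModType R) (n : nat)
    (h : 'I_n -> V -> W) (dh : 'I_n -> W) (x v : V) :
  (forall i, is_derive x v (h i) (dh i)) ->
  is_derive x v (fun t => \sum_i h i t) (\sum_i dh i).
Proof.
move=> H; have -> : (fun t => \sum_i h i t) = \sum_i h i.
  by apply/funext => t; rewrite fct_sumE.
exact: is_derive_sum.
Qed.

Lemma derive_lincomb (R : realType) (V W : normedModType R) (f : V -> W)
    (p : V) (n : nat) (c : 'I_n -> R) (e : 'I_n -> V) :
  differentiable f p ->
  'D_(\sum_i c i *: e i) f p = \sum_i c i *: 'D_(e i) f p.
Proof.
move=> df; rewrite deriveE // linear_sum; apply: eq_bigr => i _.
by rewrite linearZ deriveE.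
Qed.

Lemma derive_dirD (R : realType) (V W : normedModType R) (f : V -> W)
    (p v w : V) :
  differentiable f p -> 'D_(v + w) f p = 'D_v f p + 'D_w f p.
Proof. by move=> df; rewrite !deriveE // linearD. Qed.

Lemma derive_dirZ (R : realType) (V W : normedModType R) (f : V -> W)
    (p v : V) (a : R) :
  differentiable f p -> 'D_(a *: v) f p = a *: 'D_v f p.
Proof. by move=> df; rewrite !deriveE // linearZ. Qed.

Lemma mvt01 (R : realType) (k k' : R -> R) (b : R) :
  0 <= b -> (forall r : R, 0 <= r <= b -> is_derive r 1 k (k' r)) ->
  exists2 c, 0 <= c <= b & k b - k 0 = k' c * b.
Proof.
move=> b0 dk.
have [] := @MVT_segment R k k' 0 b b0.
- by move=> x; rewrite in_itv /= => /andP[? ?]; apply: dk; rewrite !ltW.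
- apply: derivable_within_continuous => x; rewrite in_itv /= => hx.
  by have [] := dk x hx.
by move=> c; rewrite in_itv /= subr0 => ? ?; exists c.
Qed.

(** Two mean value steps give [C] in place of the sharp [C / 2]; the factor is absorbed in an
    arbitrary eps wherever this is applied. No continuity of [k''] enters. *)
Lemma taylor2_le (R : realType) (k k' k'' : R -> R) (C : R) :
  (forall r : R, 0 <= r <= 1 -> is_derive r 1 k (k' r)) ->
  (forall r : R, 0 <= r <= 1 -> is_derive r 1 k' (k'' r)) ->
  (forall r : R, 0 <= r <= 1 -> `|k'' r| <= C) ->
  `|k 1 - k 0 - k' 0| <= C.
Proof.
move=> dk dk' hC.
have [c c01 ->] := mvt01 ler01 dk; rewrite mulr1.
have /andP[c0 c1] := c01.
have [d d01 ->] : exists2 d, 0 <= d <= c & k' c - k' 0 = k'' d * c.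
  apply: mvt01 => // r /andP[r0 rc]; apply: dk'.
  by rewrite r0 (le_trans rc).
rewrite normrM (ger0_norm c0) -[leRHS]mulr1; apply: ler_pM => //.
apply: hC; case/andP: d01 => -> dc; exact: le_trans dc c1.
Qed.

Definition qf (R : realType) (n : nat) (M : 'M[R]_n) (a b : 'rV[R]_n) : R :=
  \sum_i \sum_j M i j * (a 0 i * b 0 j).

Lemma mx_entry_le (R : realType) (m n : nat) (M : 'M[R]_(m, n)) i j :
  `|M i j| <= `|M|.
Proof.
rewrite {2}/Num.Def.normr /= mx_normrE.
exact: (le_bigmax _ (fun ij : 'I_m * 'I_n => `|M ij.1 ij.2|) (i, j)).
Qed.

Lemma ler_norm_qf (R : realType) (n : nat) (M : 'M[R]_n) (a b : 'rV[R]_n)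
    (e : R) :
  (forall i j, `|M i j| <= e) ->
  `|qf M a b| <= n%:R * (n%:R * e) * (`|a| * `|b|).
Proof.
move=> hM; rewrite /qf; apply: (le_trans (ler_norm_sum _ _ _)).
rewrite -!mulrA -[X in X%:R * _](card_ord n) -sum1_card.
rewrite natr_sum mulr_suml; apply: ler_sum => i _; rewrite mul1r.
apply: (le_trans (ler_norm_sum _ _ _)).
rewrite -[X in X%:R * _](card_ord n) -sum1_card.
rewrite natr_sum mulr_suml; apply: ler_sum => j _; rewrite mul1r.
rewrite !normrM ler_pM // ?mulr_ge0 // ler_pM //; exact: mx_entry_le.
Qed.

Lemma lincomb_le (R : realType) (V : normedModType R) (n : nat)
    (e : 'I_n -> V) (v : 'rV[R]_n) :
  `|\sum_i v 0 i *: e i| <= `|v| * \sum_i `|e i|.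
Proof.
apply: (le_trans (ler_norm_sum _ _ _)); rewrite mulr_sumr.
apply: ler_sum => i _; rewrite normrZ ler_wpM2r //; exact: mx_entry_le.
Qed.

Lemma open_norm (R : realType) (V : normedModType R) (D : set V) (q : V) :
  open D -> D q -> exists2 r : R, 0 < r & forall p, `|p - q| < r -> D p.
Proof.
move=> oD Dq; have /nbhs_ballP [r r0 h] : nbhs q D by exact: open_nbhs_nbhs.
exists r => // p pq; apply: h; by rewrite -ball_normE /= distrC.
Qed.

Lemma cont_norm (R : realType) (V W : normedModType R) (f : V -> W) (q : V)
    (e : R) :
  {for q, continuous f} -> 0 < e ->
  exists2 r : R, 0 < r & forall p, `|p - q| < r -> `|f p - f q| <= e.
Proof.
move=> cf e0.
have /cvgrPdist_le /(_ e e0) /nbhs_ballP [r r0 h] := cf.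
exists r => // p pq; rewrite distrC; apply: h.
by rewrite -ball_normE /= distrC.
Qed.

Lemma fin_min_radius (R : realType) (n : nat) (P : 'I_n -> R -> Prop) :
  (forall i, exists2 r, 0 < r & P i r) ->
  (forall i r r', r' <= r -> P i r -> P i r') ->
  exists2 r, 0 < r & forall i, P i r.
Proof.
move=> hP mono.
have /choice [f hf] : forall i, exists r, 0 < r /\ P i r.
  by move=> i; have [r r0 pr] := hP i; exists r.
exists (\big[Order.min/1]_i f i).
  by apply/bigmin_gtP; split => // i _; have [] := hf i.
move=> i; apply: (mono _ (f i)); last by have [] := hf i.
exact: bigmin_inf.
Qed.

Lemma is_derive_half_sq (R : realType) (c s : R) :
  is_derive s 1 (fun t : R => 2^-1 * t ^+ 2 * c) (s * c).
Proof.
have -> : (fun t : R => 2^-1 * t ^+ 2 * c) = (2^-1 * c) *: (id ^+ 2 : R -> R).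
  by apply/funext => t; rewrite fctE /= /GRing.scale /= mulrAC.
apply: is_derive_eq.
by rewrite /GRing.scale /= expr1; field.
Qed.

Lemma is_derive_mulr (R : realType) (c s : R) :
  is_derive s 1 (fun t : R => t * c) c.
Proof.
have -> : (fun t : R => t * c) = c *: (id : R -> R).
  by apply/funext => t; rewrite fctE /GRing.scale /= mulrC.
by apply: is_derive_eq; rewrite /GRing.scale /= mulr1.
Qed.

Lemma qfBl (R : realType) (n : nat) (M N : 'M[R]_n) (a b : 'rV[R]_n) :
  qf (M - N) a b = qf M a b - qf N a b.
Proof.
rewrite /qf -sumrB; apply: eq_bigr => i _; rewrite -sumrB.
by apply: eq_bigr => j _; rewrite !mxE mulrBl.
Qed.

(** The Hessian is frozen at [q] while the base point [p] varies near [q]: in [small2_taylor_z] the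
    base point moves along the curve. The family [e] is arbitrary, so that the same expansion serves
    the [x] directions and the single direction [z]. *)
Lemma taylor2 (R : realType) (V : normedModType R) (D : set V) (f : V -> R)
    (q : V) (n : nat) (e : 'I_n -> V) (eps : R) :
  open D -> C2_on D f -> D q -> 0 < eps ->
  exists2 r, 0 < r & forall p (v : 'rV[R]_n), `|p - q| < r -> `|v| < r ->
   `|f (p + \sum_i v 0 i *: e i) - f p - \sum_i v 0 i * 'D_(e i) f p
      - 2^-1 * qf (\matrix_(i, j) 'D_(e j) ('D_(e i) f) q) v v|
     <= eps * `|v| ^+ 2.
Proof.
move=> oD [C1 C2] Dq eps0.
pose d : R := n%:R * n%:R + 1.
have d0 : 0 < d by rewrite ltr_wpDl // mulr_ge0.
set H := \matrix_(i, j) _.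
have [r0 r00 hr0] := open_norm oD Dq.
have [r1 r10 hr1] : exists2 r1 : R, 0 < r1 & forall i j p, `|p - q| < r1 ->
   `|'D_(e j) ('D_(e i) f) p - H i j| <= eps / d.
  apply: fin_min_radius; last by move=> i r r' rr' h j p /lt_le_trans/(_ rr'); exact: h.
  move=> i; apply: fin_min_radius; last first.
    by move=> j r r' rr' h p /lt_le_trans/(_ rr'); exact: h.
  move=> j; rewrite /H !mxE; apply: cont_norm; last exact: divr_gt0.
  by have [_] := C2 (e i) q Dq; apply.
pose S := 1 + \sum_i `|e i|.
have S0 : 0 < S by rewrite ltr_pwDl // sumr_ge0.
pose r := Order.min r0 r1 / (2 * S).
have m0 : 0 < Order.min r0 r1 by rewrite lt_min r00.
have rgt0 : 0 < r by rewrite divr_gt0 // mulr_gt0.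
exists (Order.min (Order.min r0 r1 / 2) r); first by rewrite lt_min rgt0 divr_gt0.
move=> p v; rewrite !lt_min => /andP[pq _] /andP[_ vr].
set L := \sum_i v 0 i *: e i.
have near (s : R) : 0 <= s <= 1 -> `|p + s *: L - q| < Order.min r0 r1.
  move=> /andP[s0 s1]; rewrite addrAC.
  apply: (le_lt_trans (ler_normD _ _)).
  rewrite [ltRHS](splitr) ltrD //.
  rewrite normrZ ger0_norm //; apply: (@le_lt_trans _ _ `|L|).
    by rewrite ler_piMl.
  apply: (le_lt_trans (lincomb_le e v)).
  apply: (@le_lt_trans _ _ (`|v| * S)); first by rewrite ler_wpM2l // lerDr.
  by rewrite -ltr_pdivlMr // -mulrA -invfM; exact: vr.
have Dn (s : R) : 0 <= s <= 1 -> D (p + s *: L).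
  by move=> /near; rewrite lt_min => /andP[/hr0].
pose k (s : R) := f (p + s *: L) - 2^-1 * s ^+ 2 * qf H v v.
pose k' (s : R) := \sum_i v 0 i * 'D_(e i) f (p + s *: L) - s * qf H v v.
pose k'' (s : R) := qf (\matrix_(i, j) 'D_(e j) ('D_(e i) f) (p + s *: L) - H) v v.
have dk (s : R) : 0 <= s <= 1 -> is_derive s 1 k (k' s).
  move=> hs; have [df _] := C1 _ (Dn s hs).
  have := is_derive_line (@diff_derivable _ _ _ _ _ L df).
  rewrite /L derive_lincomb // -/L => dl.
  have dq := is_derive_half_sq (qf H v v) s.
  exact: is_deriveB.
have dk' (s : R) : 0 <= s <= 1 -> is_derive s 1 k' (k'' s).
  move=> hs.
  have dl i : is_derive s 1 (fun s : R => v 0 i * 'D_(e i) f (p + s *: L))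
     (v 0 i * \sum_j v 0 j * 'D_(e j) ('D_(e i) f) (p + s *: L)).
    have [df _] := C2 (e i) _ (Dn s hs).
    have := is_derive_line (@diff_derivable _ _ _ _ _ L df).
    by rewrite /L derive_lincomb // -/L => dl; exact: is_deriveZ.
  have dS := is_derive_sum_fun dl.
  have dq := is_derive_mulr (qf H v v) s.
  rewrite /k'' qfBl.
  rewrite [X in X - _](_ : _ = \sum_i
     v 0 i * \sum_j v 0 j * 'D_(e j) ('D_(e i) f) (p + s *: L)).
    exact: is_deriveB.
  rewrite /qf; apply: eq_bigr => i _; rewrite mulr_sumr.
  by apply: eq_bigr => j _; rewrite mxE; ring.
have hC (s : R) : 0 <= s <= 1 -> `|k'' s| <= eps * `|v| ^+ 2.
  move=> hs; rewrite /k''.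
  apply: (le_trans (@ler_norm_qf _ _ _ v v (eps / d) _)).
    move=> i j; rewrite !mxE.
    have := hr1 i j (p + s *: L); rewrite /H mxE; apply.
    by have := near s hs; rewrite lt_min => /andP[].
  rewrite -expr2 ler_wpM2r ?exprn_ge0 //.
  rewrite !mulrA ler_pdivrMr // mulrC ler_pM2l //.
  by rewrite /d lerDl.
have := taylor2_le dk dk' hC; rewrite /k /k' !scale1r !scale0r !addr0.
rewrite expr1n expr0n ?(mulr0, mul0r, mulr1, subr0) /=.
suff -> : f (p + L) - 2^-1 * qf H v v - f p - \sum_i v 0 i * 'D_(e i) f p =
  f (p + L) - f p - \sum_i v 0 i * 'D_(e i) f p - 2^-1 * qf H v v by [].
ring.
Qed.

Lemma is_derive_bound (R : realType) (V W : normedModType R) (f : V -> W)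
    (x v : V) (df : W) (e : R) :
  is_derive x v f df -> 0 < e ->
  exists2 r : R, 0 < r & forall h : R, `|h| < r ->
    `|f (x + h *: v) - f x - h *: df| <= e * `|h|.
Proof.
move=> [/[swap] <- /derivable_nbhs dfx] e0.
have /eqaddoP /(_ e e0) /nbhs_ballP [r r0 hr] := dfx; exists r => // h hh.
have := hr h; rewrite -ball_normE /= sub0r normrN => /(_ hh).
by rewrite !fctE /= opprD addrA [X in f X]addrC.
Qed.

Lemma diff_bound (R : realType) (V W : normedModType R) (f : V -> W) (p : V)
    (e : R) :
  differentiable f p -> 0 < e ->
  exists2 r : R, 0 < r & forall u, `|u| < r ->
    `|f (p + u) - f p - 'd f p u| <= e * `|u|.
Proof.
move=> /diff_locally dfx e0.
have /eqaddoP /(_ e e0) /nbhs_ballP [r r0 hr] := dfx; exists r => // u hu.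
have := hr u; rewrite -ball_normE /= sub0r normrN => /(_ hu).
by rewrite !fctE /= opprD addrA [X in f X]addrC.
Qed.

(** Since the derivative of [phi] at 0 exists, an estimate of the increments from the right
    determines it up to [E]; this is the passage to the limit in [taylor2_derive]. *)
Lemma derive_le_of_right (R : realType) (phi : R -> R) (d c E r : R) :
  is_derive (0 : R) 1 phi d -> 0 < r ->
  (forall t : R, 0 < t < r -> `|phi t - phi 0 - t * c| <= t * E) ->
  `|d - c| <= E.
Proof.
move=> dphi r0 h; apply/ler_addgt0Pr => e e0.
have [s s0 hs] := is_derive_bound dphi e0.
pose t := Order.min r s / 2.
have m0 : 0 < Order.min r s by rewrite lt_min r0.
have t0 : 0 < t by rewrite divr_gt0.
have tm : t < Order.min r s by rewrite /t; lra.
move: tm; rewrite lt_min => /andP[tr ts].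
have := hs t; rewrite gtr0_norm // => /(_ ts).
have -> : (0 : R) + t *: 1 = t by rewrite add0r [_ *: _]mulr1.
have := h t; rewrite t0 tr => /(_ isT) h1 h2.
rewrite -(ler_pM2l t0) -{1}(gtr0_norm t0) -normrM.
have -> : t * (d - c) = (phi t - phi 0 - t * c) - (phi t - phi 0 - t *: d).
  by rewrite /GRing.scale /=; ring.
apply: (le_trans (ler_normB _ _)); rewrite mulrDr lerD //.
by rewrite mulrC.
Qed.

Lemma norm_shift_lt (R : realType) (V : normedModType R) (a b q : V) (r : R) :
  `|a - q| < r / 2 -> `|b| < r / 2 -> `|a + b - q| < r.
Proof.
move=> ha hb; rewrite addrAC; apply: (le_lt_trans (ler_normD _ _)).
by rewrite [ltRHS](splitr r) ltrD.
Qed.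

(* Obtained by dividing the second-order remainder of [g (_ + t w) - g] by [t]
   and letting [t] tend to 0: the Hessian need only be derivable along [w], and
   no third derivatives are exchanged. *)
Lemma taylor2_derive (R : realType) (V : normedModType R) (D : set V)
    (g : V -> R) (q w : V) (n : nat) (e : 'I_n -> V) (eps : R) :
  open D -> C2_on D g -> D q -> 0 < eps ->
  (forall p, D p -> forall i j, derivable ('D_(e j) ('D_(e i) g)) p w) ->
  (forall i j, {for q, continuous ('D_w ('D_(e j) ('D_(e i) g)))}) ->
  exists2 r, 0 < r & forall v : 'rV[R]_n, `|v| < r ->
   `|'D_w g (q + \sum_i v 0 i *: e i) - 'D_w g q
      - \sum_i v 0 i * 'D_w ('D_(e i) g) q
      - 2^-1 * qf (\matrix_(i, j) 'D_w ('D_(e j) ('D_(e i) g)) q) v v|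
     <= eps * `|v| ^+ 2.
Proof.
move=> oD [C1 C2] Dq eps0 dH cH.
pose d : R := n%:R * n%:R + 1.
have d0 : 0 < d by rewrite ltr_wpDl // mulr_ge0.
set K := \matrix_(i, j) _.
have [r0 r00 hr0] := open_norm oD Dq.
have [r1 r10 hr1] : exists2 r1 : R, 0 < r1 & forall i j p, `|p - q| < r1 ->
   `|'D_w ('D_(e j) ('D_(e i) g)) p - K i j| <= eps / d.
  apply: fin_min_radius; last by move=> i r r' rr' h j p /lt_le_trans/(_ rr'); exact: h.
  move=> i; apply: fin_min_radius; last first.
    by move=> j r r' rr' h p /lt_le_trans/(_ rr'); exact: h.
  by move=> j; rewrite /K !mxE; apply: cont_norm; [exact: cH|exact: divr_gt0].
pose m := Order.min r0 r1.
have m0 : 0 < m by rewrite lt_min r00.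
have hm p : `|p - q| < m -> D p /\ forall i j,
   `|'D_w ('D_(e j) ('D_(e i) g)) p - K i j| <= eps / d.
  by rewrite lt_min => /andP[/hr0 ? h1]; split => // i j; exact: hr1.
pose S := 1 + \sum_i `|e i|.
have S0 : 0 < S by rewrite ltr_pwDl // sumr_ge0.
have S'0 : 0 < 1 + `|w| by rewrite ltr_pwDl.
exists (m / 2 / S); first by rewrite !divr_gt0.
move=> v hv.
set L := \sum_i v 0 i *: e i.
have nL (s : R) : 0 <= s <= 1 -> `|s *: L| < m / 2.
  move=> /andP[s0 s1]; rewrite normrZ ger0_norm //; apply: (@le_lt_trans _ _ `|L|).
    by rewrite ler_piMl.
  apply: (le_lt_trans (lincomb_le e v)).
  apply: (@le_lt_trans _ _ (`|v| * S)); first by rewrite ler_wpM2l // lerDr.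
  by rewrite -ltr_pdivlMr.
pose rt := m / 2 / (1 + `|w|).
have rt0 : 0 < rt by rewrite !divr_gt0.
have nw (t : R) : 0 <= t < rt -> `|t *: w| < m / 2.
  move=> /andP[t0 tr]; rewrite normrZ ger0_norm //.
  apply: (@le_lt_trans _ _ (t * (1 + `|w|))); first by rewrite ler_wpM2l // lerDr.
  by rewrite -ltr_pdivlMr.
have near (s t : R) : 0 <= s <= 1 -> 0 <= t < rt ->
    `|q + s *: L + t *: w - q| < m.
  move=> hs ht; apply: norm_shift_lt; last exact: nw.
  by rewrite addrAC subrr add0r; exact: nL.
have Dn (s t : R) : 0 <= s <= 1 -> 0 <= t < rt -> D (q + s *: L + t *: w).
  by move=> hs ht; have [] := hm _ (near s t hs ht).
have z01 : 0 <= (0 : R) <= 1 by rewrite lexx ler01.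
have o01 : 0 <= (1 : R) <= 1 by rewrite lexx ler01.
have zrt : 0 <= (0 : R) < rt by rewrite lexx.
(* The first-order remainder of [g] with base point [q + t *: w]; its derivative at 0 is the
   first-order remainder of ['D_w g] at [q]. *)
pose phi (t : R) := g (q + L + t *: w) - g (q + t *: w)
    - \sum_i v 0 i * 'D_(e i) g (q + t *: w).
have dphi : is_derive (0 : R) 1 phi ('D_w g (q + L) - 'D_w g q
      - \sum_i v 0 i * 'D_w ('D_(e i) g) q).
  have D1 := Dn 1 0 o01 zrt; rewrite scale1r in D1.
  have D0 := Dn 0 0 z01 zrt; rewrite scale0r addr0 in D0.
  have [g1 _] := C1 _ D1; have [g0 _] := C1 _ D0.
  have a1 := is_derive_line (@diff_derivable _ _ _ _ _ w g1).
  have a0 := is_derive_line (@diff_derivable _ _ _ _ _ w g0).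
  have ai i : is_derive (0:R) 1 (fun t => v 0 i * 'D_(e i) g (q + t *: w))
      (v 0 i * 'D_w ('D_(e i) g) (q + (0:R) *: w)).
    have [gi _] := C2 (e i) _ D0.
    have := is_derive_line (@diff_derivable _ _ _ _ _ w gi) => b.
    exact: is_deriveZ.
  have as_ := is_derive_sum_fun ai.
  rewrite scale0r addr0 in a1; rewrite scale0r addr0 in a0.
  rewrite scale0r addr0 in as_.
  exact: is_deriveB.
apply: (derive_le_of_right dphi rt0) => t /andP[t0 tr].
have ht : 0 <= t < rt by rewrite ltW.
(* For fixed [t], the Taylor remainder of [k] between 0 and 1 is the increment of [phi] minus its
   expected quadratic part. *)
pose k (s : R) := g (q + t *: w + s *: L) - g (q + s *: L)
   - 2^-1 * s ^+ 2 * (t * qf K v v).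
pose k' (s : R) := \sum_i v 0 i * 'D_(e i) g (q + t *: w + s *: L)
   - \sum_i v 0 i * 'D_(e i) g (q + s *: L) - s * (t * qf K v v).
pose Hs p := \matrix_(i, j) 'D_(e j) ('D_(e i) g) p.
pose k'' (s : R) :=
  qf (Hs (q + t *: w + s *: L) - Hs (q + s *: L) - t *: K) v v.
have dg p (s : R) : D (p + s *: L) ->
   is_derive s 1 (fun s => g (p + s *: L)) (\sum_i v 0 i * 'D_(e i) g (p + s *: L)).
  move=> Dp; have [df _] := C1 _ Dp.
  by have := is_derive_line (@diff_derivable _ _ _ _ _ L df);
    rewrite /L derive_lincomb.
have dg' p (s : R) : D (p + s *: L) ->
   is_derive s 1 (fun s => \sum_i v 0 i * 'D_(e i) g (p + s *: L))
     (qf (Hs (p + s *: L)) v v).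
  move=> Dp.
  have dl i : is_derive s 1 (fun s : R => v 0 i * 'D_(e i) g (p + s *: L))
     (v 0 i * \sum_j v 0 j * 'D_(e j) ('D_(e i) g) (p + s *: L)).
    have [df _] := C2 (e i) _ Dp.
    have := is_derive_line (@diff_derivable _ _ _ _ _ L df).
    by rewrite /L derive_lincomb // -/L => dl; exact: is_deriveZ.
  have := is_derive_sum_fun dl.
  rewrite (_ : \sum_i v 0 i * _ = qf (Hs (p + s *: L)) v v) //.
  rewrite /qf; apply: eq_bigr => i _; rewrite mulr_sumr.
  by apply: eq_bigr => j _; rewrite mxE; ring.
have D1 (s : R) : 0 <= s <= 1 -> D (q + t *: w + s *: L).
  by move=> hs; rewrite addrAC; exact: Dn.
have D0 (s : R) : 0 <= s <= 1 -> D (q + s *: L).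
  by move=> hs; have := Dn s 0 hs zrt; rewrite scale0r addr0.
have dk (s : R) : 0 <= s <= 1 -> is_derive s 1 k (k' s).
  move=> hs; have d1 := dg _ _ (D1 s hs); have d2 := dg _ _ (D0 s hs).
  have dq := is_derive_half_sq (t * qf K v v) s.
  exact: is_deriveB.
have dk' (s : R) : 0 <= s <= 1 -> is_derive s 1 k' (k'' s).
  move=> hs; have d1 := dg' _ _ (D1 s hs); have d2 := dg' _ _ (D0 s hs).
  have dq := is_derive_mulr (t * qf K v v) s.
  rewrite /k'' qfBl qfBl.
  have -> : qf (t *: K) v v = t * qf K v v.
    rewrite /qf mulr_sumr; apply: eq_bigr => i _; rewrite mulr_sumr.
    by apply: eq_bigr => j _; rewrite !mxE; ring.
  exact: (is_deriveB (is_deriveB d1 d2) dq).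
have hC (s : R) : 0 <= s <= 1 -> `|k'' s| <= t * (eps * `|v| ^+ 2).
  move=> hs; rewrite /k''.
  apply: (le_trans (@ler_norm_qf _ _ _ v v (t * (eps / d)) _)).
    move=> i j; rewrite !mxE.
    set h := 'D_(e j) _.
    (* The mean value theorem along [w] turns the difference of the two Hessian entries into [t]
       times a derivative close to [K i j], which supplies the factor [t] needed for the
       division. *)
    have [c /andP[c0 ct]] : exists2 c, 0 <= c <= t &
       h (q + s *: L + t *: w) - h (q + s *: L + (0:R) *: w)
        = 'D_w h (q + s *: L + c *: w) * t.
      apply: (@mvt01 _ (fun c => h (q + s *: L + c *: w))
         (fun c => 'D_w h (q + s *: L + c *: w))); first exact: ltW.
      move=> c /andP[c0 ct]; apply: is_derive_line; apply: dH; apply: Dn => //.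
      by rewrite c0 (le_lt_trans ct).
    rewrite scale0r addr0 [q + t *: w + _]addrAC => ->.
    have hc : 0 <= c < rt by rewrite c0 (le_lt_trans ct).
    have [_ /(_ i j)] := hm _ (near s c hs hc); rewrite /K mxE -/h => hh.
    rewrite [_ * t]mulrC -mulrBr normrM (gtr0_norm t0) ler_wpM2l ?(ltW t0) //.
  rewrite -expr2 [leRHS]mulrA ler_wpM2r ?exprn_ge0 //.
  rewrite (_ : _ * _ = t * (n%:R * n%:R * eps / d)); last by ring.
  rewrite ler_pM2l // ler_pdivrMr // mulrC ler_pM2l //.
  by rewrite /d lerDl.
have := taylor2_le dk dk' hC; rewrite /k /k' /phi !scale1r !scale0r !addr0.
rewrite expr1n expr0n ?(mulr0, mul0r, mulr1, subr0) /=.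
rewrite [q + L + _]addrAC => h.
apply: le_trans h; rewrite le_eqVlt; apply/orP; left; apply/eqP; congr (`|_|).
ring.
Qed.

(** * Local inversion of injective maps *)

Lemma is_derive_entry (R : realType) (V : normedModType R) (m n : nat)
    (M : V -> 'M[R]_(m, n)) (x v : V) (dM : 'M[R]_(m, n)) i j :
  is_derive x v M dM -> is_derive x v (fun t => M t i j) (dM i j).
Proof.
move=> [dM1 <-]; split; first exact: (iffLR (derivable_mxP _ _ _)).
by rewrite derive_mx // mxE.
Qed.

Lemma norm_mulmx_le (R : realType) (m n : nat) (v : 'rV[R]_m)
    (M : 'M[R]_(m, n)) : `|v *m M| <= `|v| * (m%:R * `|M|).
Proof.
rewrite [leLHS]/Num.Def.normr /= mx_normrE.
apply/bigmax_leP; split => [|[i j] _]; first by rewrite !mulr_ge0.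
rewrite mxE; apply: (le_trans (ler_norm_sum _ _ _)).
rewrite mulrCA -[X in X%:R * _](card_ord m) -sum1_card.
rewrite natr_sum mulr_suml; apply: ler_sum => k _; rewrite mul1r normrM.
by rewrite ler_pM //; exact: mx_entry_le.
Qed.

(** The norm of rows is the maximum norm, which is not differentiable; the Euclidean square is the
    quantity that gets minimised below. *)
Lemma norm_row_sqr_le (R : realType) (n : nat) (v : 'rV[R]_n) :
  `|v| ^+ 2 <= \sum_i v 0 i ^+ 2 <= n%:R * `|v| ^+ 2.
Proof.
apply/andP; split; last first.
  rewrite -[X in X%:R * _](card_ord n) -sum1_card.
  rewrite natr_sum mulr_suml; apply: ler_sum => k _; rewrite mul1r.
  by rewrite -real_normK ?num_real // lerXn2r ?nnegrE //; exact: mx_entry_le.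
have [/eqP|v0] := eqVneq `|v| 0.
  by move=> /eqP ->; rewrite expr0n /= sumr_ge0 // => i _; rewrite sqr_ge0.
have [[i j] /= hij] := mx_norm_neq0 v0.
rewrite {1}/Num.Def.normr /= hij (ord1 i) real_normK ?num_real //.
by rewrite (bigD1 j) //= lerDl sumr_ge0 // => k _; rewrite sqr_ge0.
Qed.

Lemma is_derive_sqr (R : realType) (V : normedModType R) (f : V -> R)
    (x v : V) (df : R) :
  is_derive x v f df -> is_derive x v (fun t => f t ^+ 2) (2 * f x * df).
Proof.
move=> d.
have -> : (fun t => f t ^+ 2) = f * f by apply/funext => t; rewrite expr2.
by apply: is_derive_eq; rewrite /GRing.scale /=; ring.
Qed.

Lemma cvg_sumr (R : realType) (T : Type) (F : set_system T) (n : nat)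
    (f : 'I_n -> T -> R) (a : 'I_n -> R) : Filter F ->
  (forall i, f i x @[x --> F] --> a i) ->
  \sum_i f i x @[x --> F] --> \sum_i a i.
Proof. by move=> FF h; apply: cvg_big => //; exact: add_continuous. Qed.

Lemma local_min_derive (R : realType) (f : R -> R) (df r : R) :
  0 < r -> is_derive (0 : R) 1 f df ->
  (forall t : R, `|t| < r -> derivable f t 1) ->
  (forall t : R, `|t| < r -> f 0 <= f t) -> df = 0.
Proof.
move=> r0 [_ <-] dr hm.
have [] // := @derive1_at_min R f (- r) r 0.
- by rewrite (le_trans (_ : _ <= 0)) ?oppr_le0 // ltW.
- by move=> t; rewrite in_itv /= -ltr_norml; exact: dr.
- by rewrite in_itv /= oppr_lt0 r0.
by move=> t; rewrite in_itv /= -ltr_norml; exact: hm.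
Qed.

Lemma derivable_line (R : realType) (V W : normedModType R) (f : V -> W)
    (p v : V) (r : R) :
  derivable f (p + r *: v) v -> derivable (fun s : R => f (p + s *: v)) r 1.
Proof. by move=> /is_derive_line []. Qed.

Lemma dist_continuous (R : realType) (U V : normedModType R) (f : U -> V)
    (a : V) (x : U) :
  {for x, continuous f} -> {for x, continuous (fun x => `|f x - a|)}.
Proof.
by move=> cf; apply: cvg_norm; apply: cvgB; [exact: cf|exact: cvg_cst].
Qed.

Lemma sum_sqr_continuous (R : realType) (U : normedModType R) (n : nat)
    (F : U -> 'rV[R]_n) (q : 'rV[R]_n) (y : U) :
  {for y, continuous F} ->
  {for y, continuous (fun x => \sum_i (F x 0 i - q 0 i) ^+ 2)}.
Proof.
move=> cF; apply: cvg_sumr => i.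
have ci : F x 0 i - q 0 i @[x --> y] --> F y 0 i - q 0 i.
  apply: cvgB; last exact: cvg_cst.
  exact: (cvg_comp _ _ cF (@coord_continuous _ _ _ 0 i (F y))).
by rewrite expr2; under eq_fun do rewrite expr2; exact: cvgM.
Qed.

(* A point of a small closed ball minimising [|F x - q|^2] is interior by
   injectivity, hence critical, hence a solution of [F x = q] because the
   differential is invertible. *)
Lemma injective_open_map (R : realType) (n : nat) (F : 'rV[R]_n -> 'rV[R]_n)
    (B : 'rV[R]_n -> 'M[R]_n) (Om : set 'rV[R]_n) (x0 : 'rV[R]_n) (r : R) :
  open Om -> set_inj Om F ->
  (forall x, Om x -> differentiable F x) ->
  (forall x, Om x -> B x \in unitmx /\ forall v, 'D_v F x = v *m B x) ->
  Om x0 -> 0 < r ->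
  exists2 s, 0 < s & forall q, `|q - F x0| < s ->
    exists x, [/\ `|x - x0| < r, Om x & F x = q].
Proof.
move=> oO injF dF hB Ox0 r0.
have [r1 r10 hr1] := open_norm oO Ox0.
pose r' := Order.min r r1 / 2.
have m0 : 0 < Order.min r r1 by rewrite lt_min r0.
have r'0 : 0 < r' by rewrite divr_gt0.
have : r' < Order.min r r1 by rewrite /r'; lra.
rewrite lt_min => /andP[r'r r'r1].
have inO x : `|x - x0| <= r' -> Om x.
  by move=> h; apply: hr1; exact: le_lt_trans h _.
have cF x : Om x -> {for x, continuous F}.
  by move=> /dF; exact: differentiable_continuous.
have cn : continuous (fun x : 'rV[R]_n => `|x - x0|).
  by move=> x; exact: dist_continuous.
have ball_b (A : set 'rV[R]_n) : (forall x, A x -> `|x - x0| <= r') ->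
    bounded_set A.
  move=> hA; exists (r' + `|x0|); split; first exact: num_real.
  move=> M hM x /hA hx /=; apply: ltW; apply: le_lt_trans hM.
  by rewrite -(subrK x0 x) (le_trans (ler_normD _ _)) // lerD.
pose K := [set x : 'rV[R]_n | `|x - x0| <= r'].
pose Sg := [set x : 'rV[R]_n | `|x - x0| = r'].
have cK : compact K.
  apply: bounded_closed_compact; first exact: ball_b.
  by apply: (preimage_closed _ (@closed_le _ r')) => x _; exact: cn.
have cS : compact Sg.
  apply: bounded_closed_compact; first by apply: ball_b => x /= ->.
  by apply: (preimage_closed _ (@closed_eq _ r')) => x _; exact: cn.
(* Injectivity keeps [F] away from [F x0] on the sphere. The sphere is empty when [n] is 0, whence
   the default value 1. *)
have [mu mu0 hmu] : exists2 mu, 0 < mu & forall x, Sg x -> mu <= `|F x - F x0|.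
  have [[x Sx]|S0] := pselect (Sg !=set0); last first.
    by exists 1 => // x Sx; case: S0; exists x.
  have [|c] := @EVT_min_rV R n (fun x => `|F x - F x0|) Sg (ex_intro _ x Sx) cS.
    apply: continuous_in_subspaceT => y; rewrite inE => /= Sy.
    by apply: dist_continuous; apply: cF; apply: inO; rewrite Sy.
  rewrite inE => Sc hc; exists `|F c - F x0|; last first.
    by move=> y Sy; apply: hc; rewrite inE.
  rewrite normr_gt0 subr_eq0; apply/eqP => E.
  have : c = x0 by apply: injF; rewrite ?inE //; apply: inO; rewrite Sc.
  move=> e; move: Sc; rewrite /Sg /= e subrr normr0 => e0.
  by rewrite -e0 ltxx in r'0.
(* With this choice [mu - s] equals (2n + 1) s, so that n s^2, a bound for the objective at [x0], is
   less than [(mu - s) ^+ 2], a lower bound for it on the sphere. *)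
pose s := mu / (2 * (n%:R + 1)).
have n10 : 0 < n%:R + 1 :> R by rewrite ltr_wpDl.
have s0 : 0 < s by rewrite divr_gt0 // mulr_gt0.
exists s => // q hq.
pose N x := \sum_i (F x 0 i - q 0 i) ^+ 2.
have hN0 : N x0 < (mu - s) ^+ 2.
  have := norm_row_sqr_le (F x0 - q) => /andP[_].
  rewrite (_ : \sum_i _ = N x0); last by apply: eq_bigr => i _; rewrite !mxE.
  rewrite distrC => /le_lt_trans; apply.
  have s2 : s * (2 * (n%:R + 1)) = mu by rewrite /s divfK // gt_eqF // mulr_gt0.
  have hn : 0 <= n%:R :> R by [].
  have q0 : 0 <= `|q - F x0| by [].
  apply: (@le_lt_trans _ _ (n%:R * s ^+ 2)).
    by rewrite ler_wpM2l // lerXn2r ?nnegrE // ltW.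
  rewrite -s2; nra.
have NS x : Sg x -> (mu - s) ^+ 2 <= N x.
  move=> Sx; have /andP[+ _] := norm_row_sqr_le (F x - q).
  rewrite (_ : \sum_i _ = N x); last by apply: eq_bigr => i _; rewrite !mxE.
  apply: le_trans.
  have sm : s <= mu.
    rewrite /s ler_pdivrMr ?mulr_gt0 //; have : 0 <= n%:R :> R by []. nra.
  rewrite lerXn2r ?nnegrE ?subr_ge0 //.
  rewrite lerBlDr (le_trans (hmu x Sx)) // -(subrKA q) (le_trans (ler_normD _ _)) //.
  by rewrite lerD2l // ltW.
have dN x v : Om x -> is_derive x v N (\sum_i 2 * (F x 0 i - q 0 i) * ('D_v F x) 0 i).
  move=> /dF dFx; apply: is_derive_sum_fun => i.
  have di : is_derive x v (fun x => F x 0 i - q 0 i) (('D_v F x) 0 i - 0).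
    apply: is_deriveB.
    exact/is_derive_entry/derivableP/diff_derivable.
  by rewrite subr0 in di; exact: is_derive_sqr.
have K0 : K !=set0 by exists x0; rewrite /K /= subrr normr0 ltW.
have cN : {within K, continuous N}.
  apply: continuous_in_subspaceT => y; rewrite inE => /= Ky.
  by apply: sum_sqr_continuous; apply: cF; exact: inO.
have [c] := EVT_min_rV K0 cK cN.
rewrite inE /= => Kc hc.
have cr : `|c - x0| < r'.
  rewrite lt_neqAle Kc andbT; apply/eqP => Sc.
  have := NS c Sc; rewrite leNgt => /negP; apply; apply: le_lt_trans hN0.
  by apply: hc; rewrite inE /K /= subrr normr0 ltW.
have Oc : Om c by exact: inO.
exists c; split => //; first exact: lt_trans cr _.
have [Bu hD] := hB c Oc.
(* Along [v] the derivative of [F] is [F c - q] itself, so criticality along this single line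
   already makes the sum of squares vanish. *)
pose v := (F c - q) *m invmx (B c).
have Dv : 'D_v F c = F c - q by rewrite hD /v mulmxKV.
have [rho rho0 hrho] : exists2 rho : R, 0 < rho &
    forall t : R, `|t| < rho -> `|c + t *: v - x0| <= r'.
  exists ((r' - `|c - x0|) / (1 + `|v|)).
    by rewrite divr_gt0 ?subr_gt0 // ltr_pwDl.
  have v1 : 0 < 1 + `|v| by rewrite ltr_pwDl.
  move=> t; rewrite ltr_pdivlMr // => ht.
  have tv : `|t *: v| <= `|t| * (1 + `|v|).
    by rewrite normrZ ler_wpM2l // lerDr.
  rewrite addrAC; apply: (le_trans (ler_normD _ _)); lra.
have /(local_min_derive rho0) : is_derive (0 : R) 1 (fun t => N (c + t *: v))
    (\sum_i 2 * (F c 0 i - q 0 i) * ('D_v F c) 0 i).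
  have := dN c v Oc => -[h1 h2].
  have := @is_derive_line _ _ _ N c v 0; rewrite scale0r addr0 => /(_ h1).
  by rewrite h2.
rewrite Dv => H.
have {H} : \sum_i 2 * (F c 0 i - q 0 i) * (F c - q) 0 i = 0.
  apply: H => t ht.
    by apply: derivable_line; have [] := dN _ v (inO _ (hrho t ht)).
  by rewrite scale0r addr0; apply: hc; rewrite inE; exact: hrho.
move=> S0; apply/rowP => i; apply/eqP; rewrite -subr_eq0 -sqrf_eq0.
have : \sum_i 2 * (F c 0 i - q 0 i) ^+ 2 = 0.
  by rewrite -[RHS]S0; apply: eq_bigr => j _; rewrite !mxE expr2 mulrA.
move=> /eqP; rewrite psumr_eq0; last first.
  by move=> j _; rewrite mulr_ge0 // sqr_ge0.
by move=> /allP /(_ i); rewrite mem_index_enum => /(_ isT); rewrite mulf_eq0 pnatr_eq0.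
Qed.

Lemma is_derive_of_bound (R : realType) (V W : normedModType R) (f : V -> W)
    (x v : V) (df : W) :
  (forall e : R, 0 < e -> exists2 r : R, 0 < r & forall h : R, `|h| < r ->
    `|f (x + h *: v) - f x - h *: df| <= e * `|h|) ->
  is_derive x v f df.
Proof.
move=> hb.
have cv : h^-1 *: ((f \o shift x) (h *: v) - f x) @[h --> 0^'] --> df.
  apply/cvgrPdist_le => e e0; have [r r0 hr] := hb e e0.
  apply/nbhs_ballP; exists r => //= h; rewrite /ball /= sub0r normrN => hh h0.
  rewrite distrC -(ler_pM2l (_ : 0 < `|h|)) ?normr_gt0 //.
  rewrite -normrZ scalerBr scalerA divff // scale1r [leRHS]mulrC [h *: v + x]addrC.
  exact: hr.
by split; [apply/cvg_ex; exists df|exact: cvg_lim cv].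
Qed.

(** Differentiability of [F] at [c t0] gives |u - h xi| <= e2 |u| for the increment u of [c].
    Continuity of [c] makes u small enough for this estimate, which then bounds u linearly in h and
    so improves itself to differentiability. *)
Lemma inverse_curve_derive (R : realType) (n : nat)
    (F : 'rV[R]_n -> 'rV[R]_n) (B : 'M[R]_n) (c : R -> 'rV[R]_n)
    (D : 'rV[R]_n) (t0 r0 : R) :
  differentiable F (c t0) -> (forall v, 'D_v F (c t0) = v *m B) ->
  B \in unitmx -> {for t0, continuous c} -> 0 < r0 ->
  (forall h : R, `|h| < r0 -> F (c (t0 + h)) = F (c t0) + h *: D) ->
  is_derive t0 1 c (D *m invmx B).
Proof.
move=> dF hB Bu cc r00 hF; set xi := D *m invmx B.
apply: is_derive_of_bound => e e0.
pose C0 : R := n%:R * `|invmx B| + 1.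
have C00 : 0 < C0 by rewrite ltr_wpDl // mulr_ge0.
(* The bound 1/2 lets |u| be absorbed, giving |u| <= 2 |h| |xi|; the other bound then makes e2 |u|
   at most e |h|. *)
pose e2 := Order.min (1 / 2) (e / (2 * `|xi| + 1)).
have x1 : 0 < 2 * `|xi| + 1 by rewrite ltr_wpDl // mulr_ge0.
have e20 : 0 < e2 by rewrite lt_min !divr_gt0.
have [r1 r10 hr1] := diff_bound dF (divr_gt0 e20 C00).
have r12 : 0 < r1 / 2 by rewrite divr_gt0.
have [r2 r20 hr2] := cont_norm cc r12.
exists (Order.min r0 r2); first by rewrite lt_min r00.
move=> h; rewrite lt_min => /andP[hr0 hr2'].
have -> : h *: (1 : R) = h by rewrite [_ *: _]mulr1.
set u := c (t0 + h) - c t0.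
have ur : `|u| < r1.
  apply: (@le_lt_trans _ _ (r1 / 2)); last by lra.
  by apply: hr2; rewrite addrAC subrr add0r.
have := hr1 u ur; rewrite -deriveE // hB.
rewrite /u [c t0 + _]addrC subrK hF // [F (c t0) + _]addrC addrK -/u => hu.
have uh : `|u - h *: xi| <= e2 * `|u|.
  have -> : u - h *: xi = - ((h *: D - u *m B) *m invmx B).
    by rewrite mulmxBl mulmxK // -scalemxAl opprB.
  rewrite normrN; apply: (le_trans (norm_mulmx_le _ _)).
  apply: (@le_trans _ _ (e2 / C0 * `|u| * C0)).
    by rewrite ler_pM // ?mulr_ge0 // /C0 lerDl.
  by rewrite mulrAC divfK // gt_eqF.
have e2a : e2 <= 1 / 2 by rewrite /e2 ge_min lexx.
have e2b : e2 * (2 * `|xi| + 1) <= e.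
  by rewrite -ler_pdivlMr // /e2 ge_min lexx orbT.
have u2 : `|u| <= 2 * (`|h| * `|xi|).
  have : `|u| <= `|u - h *: xi| + `|h *: xi|.
    by rewrite -{1}(subrK (h *: xi) u) ler_normD.
  by rewrite normrZ; have := normr_ge0 u; nra.
apply: (le_trans uh).
have := normr_ge0 h; have := normr_ge0 xi; nra.
Qed.

(** * Derivatives of the Hessian through the matrix A *)

Lemma is_derive_comp_curve (R : realType) (V W : normedModType R) (f : V -> W)
    (c : R -> V) (t : R) (dc : V) :
  differentiable f (c t) -> is_derive t 1 c dc ->
  is_derive t 1 (fun s => f (c s)) ('D_dc f (c t)).
Proof.
move=> df [dct <-].
have dc' : differentiable c t by apply/derivable1_diffP.
have dfc : differentiable (f \o c) t by exact: differentiable_comp.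
split; first exact: (@diff_derivable _ _ _ (f \o c)).
rewrite (@deriveE _ _ _ (f \o c)) // diff_comp //=.
by rewrite [RHS]deriveE // (deriveE _ dc').
Qed.

Lemma is_derive_pair (R : realType) (U V W : normedModType R) (f : U -> V)
    (g : U -> W) (x v : U) df dg :
  is_derive x v f df -> is_derive x v g dg ->
  is_derive x v (fun t => (f t, g t)) (df, dg).
Proof.
move=> Hf Hg; apply: is_derive_of_bound => e e0.
have [r1 r10 h1] := is_derive_bound Hf e0.
have [r2 r20 h2] := is_derive_bound Hg e0.
exists (Order.min r1 r2); first by rewrite lt_min r10.
move=> h; rewrite lt_min => /andP[/h1 ha /h2 hb].
by rewrite prod_normE /= ge_max; apply/andP; split.
Qed.

Lemma is_derive_row (R : realType) (U : normedModType R) (n : nat)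
    (f : 'I_n -> U -> R) (x v : U) (df : 'I_n -> R) :
  (forall i, is_derive x v (f i) (df i)) ->
  is_derive x v (fun t => \row_i f i t) (\row_i df i).
Proof.
move=> h.
have d : derivable (fun t => \row_i f i t) x v.
  apply/derivable_mxP => i j.
  have -> : (fun t => (\row_i f i t) i j) = f j by apply/funext => t; rewrite mxE.
  by have [] := h j.
split => //; rewrite derive_mx //; apply/rowP => j; rewrite !mxE.
have -> : (fun t => (\row_i f i t) 0 j) = f j by apply/funext => t; rewrite mxE.
by have [] := h j.
Qed.

Lemma sum_dx (R : realType) (n : nat) (v : 'rV[R]_n) :
  \sum_i v 0 i *: dx R i = (v, 0, 0).
Proof.
rewrite {2}(row_sum_delta v).
by elim/big_rec2: _ => [//|i d [[a b] c] _ [-> -> ->]];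
  rewrite /dx; congr (_, _, _); rewrite /= ?scaler0 ?addr0.
Qed.

Lemma sum_dp (R : realType) (n : nat) (v : 'rV[R]_n) :
  \sum_i v 0 i *: dp R i = (0, 0, v).
Proof.
rewrite {2}(row_sum_delta v).
by elim/big_rec2: _ => [//|i d [[a b] c] _ [-> -> ->]];
  rewrite /dp; congr (_, _, _); rewrite /= ?scaler0 ?addr0.
Qed.

Lemma sum_dy (R : realType) (n : nat) (v : 'rV[R]_n) :
  \sum_i v 0 i *: dy R i = (0, v, 0).
Proof.
rewrite {2}(row_sum_delta v).
by elim/big_rec2: _ => [//|i d [[a b] c] _ [-> -> ->]];
  rewrite /dy; congr (_, _, _); rewrite /= ?scaler0 ?addr0.
Qed.

(** By A1 the pair selected by [YZ] is the original (y, z). Through this identity the regularity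
    assumed of [A] passes to the Hessian of [g]. *)
Lemma Amx_g (R : realType) (n : nat) (G : set (xyz R n)) (g : xyz R n -> R)
    (q : xyz R n) :
  A1 G g -> G q -> Amx G g (q.1.1, g q, g_x g q) = g_xx g q.
Proof.
case: q => -[x y] z hA1 Gq /=; rewrite /Amx /=.
set w := (x, g _, g_x g _).
suff -> : YZ G g w = (y, z) by [].
rewrite /YZ; case: xgetP => [[y' z'] _ [/= h1 h2 h3]|/(_ (y, z)) []] //.
by apply: (hA1 x); rewrite ?inE //= h2 h3.
Qed.

Lemma continuous_row (R : realType) (U : normedModType R) (n : nat)
    (f : 'I_n -> U -> R) (x : U) :
  (forall i, {for x, continuous (f i)}) ->
  {for x, continuous (fun t => \row_i f i t)}.
Proof.
move=> cf; apply/cvgrPdist_le => e e0.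
have [r r0 hr] : exists2 r : R, 0 < r & forall i p, `|p - x| < r ->
    `|f i p - f i x| <= e.
  apply: fin_min_radius => [i|i r r' rr' h p /lt_le_trans/(_ rr')]; last exact: h.
  exact: cont_norm.
apply/nbhs_ballP; exists r => //= t; rewrite -ball_normE /= distrC => ht.
rewrite distrC [leLHS]/Num.Def.normr /= mx_normrE.
apply/bigmax_leP; split => [|[k i] _ /=]; first exact: ltW.
by rewrite !mxE; exact: hr.
Qed.

Lemma continuous_entry (R : realType) (U : normedModType R) (m n : nat)
    (M : U -> 'M[R]_(m, n)) (x : U) i j :
  {for x, continuous M} -> {for x, continuous (fun t => M t i j)}.
Proof.
by move=> cM; exact: (cvg_comp _ _ cM (@coord_continuous _ _ _ i j (M x))).
Qed.

Lemma delta_mx_norm_le (R : realType) (n : nat) (i : 'I_n) :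
  `|delta_mx 0 i : 'rV[R]_n| <= 1.
Proof.
rewrite [leLHS]/Num.Def.normr /= mx_normrE.
apply/bigmax_leP; split => [|[k j] _ /=]; first exact: ler01.
by rewrite !mxE; case: (_ && _); rewrite ?normr1 ?normr0.
Qed.

Section hessian.
Variables (R : realType) (n : nat) (G : set (xyz R n)) (g : xyz R n -> R).
Hypotheses (hg : generating_function G g) (hA1 : A1 G g).
Hypothesis hA : twice_differentiable_on (U G g) (Amx G g).

Let oG : open G. Proof. by case: hg => -[]. Qed.
Let C2 : C2_on G g. Proof. by case: hg. Qed.

Definition xup_of (q : xyz R n) : xup R n := (q.1.1, g q, g_x g q).

Lemma U_xup_of q : G q -> U G g (xup_of q).
Proof. by case: q => -[x y] z Gq; exists y, z. Qed.

Lemma diff_g q : G q -> differentiable g q.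
Proof. by move=> Gq; have [] := C2.1 q Gq. Qed.

Lemma diff_Dg q v : G q -> differentiable ('D_v g) q.
Proof. by move=> Gq; have [] := C2.2 v q Gq. Qed.

Lemma continuous_DDg q v w : G q -> {for q, continuous ('D_w ('D_v g))}.
Proof. by move=> Gq; have [_] := C2.2 v q Gq; apply. Qed.

(* Derivative of [xup_of] in a direction that fixes [x]. *)
Definition dxup (q w : xyz R n) : xup R n :=
  (0, 'D_w g q, \row_i 'D_w ('D_(dx R i) g) q).

Lemma is_derive_xup_of q w : G q -> w.1.1 = 0 ->
  is_derive (0 : R) 1 (fun t : R => xup_of (q + t *: w)) (dxup q w).
Proof.
case: q w => -[x y] z [[w1 a] b] Gq /= ->.
set w := (0, a, b); set q := (x, y, z).
have Dg := is_derive_line (@diff_derivable _ _ _ g _ w (diff_g (q := q + 0 *: w) _)).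
have Dgx i := is_derive_line (@diff_derivable _ _ _ ('D_(dx R i) g) _ w
  (diff_Dg (q := q + 0 *: w) _ _)).
have -> : (fun t : R => xup_of (q + t *: w)) = fun t : R =>
   (x, g (q + t *: w), \row_i 'D_(dx R i) g (q + t *: w)).
  by apply/funext => t; rewrite /xup_of /= scaler0 addr0.
rewrite scale0r addr0 in Dg Dgx.
apply: is_derive_pair; first apply: is_derive_pair.
- exact: Dg.
- by apply: is_derive_row => i; exact: Dgx.
Qed.

Lemma g_xx_Amx q : G q -> g_xx g q = Amx G g (xup_of q).
Proof. by move=> Gq; rewrite Amx_g. Qed.

(** On the open set [G] the Hessian is [A] composed with [xup_of], and [xup_of] involves first
    derivatives of [g] only, so a third derivative of [g] exists along [w]. *)
Lemma is_derive_hessian q w : G q -> w.1.1 = 0 ->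
  is_derive q w (g_xx g) ('D_(dxup q w) (Amx G g) (xup_of q)).
Proof.
move=> Gq w0.
have dA : differentiable (Amx G g) (xup_of (q + (0:R) *: w)).
  by rewrite scale0r addr0; have [] := hA (U_xup_of Gq).
have := is_derive_comp_curve dA (is_derive_xup_of Gq w0).
rewrite scale0r addr0 => H.
apply: is_derive_of_bound => e e0.
have [r1 r10 h1] := is_derive_bound H e0.
have [r2 r20 h2] := open_norm oG Gq.
exists (Order.min r1 (r2 / (1 + `|w|))).
  by rewrite lt_min r10 divr_gt0 // ltr_pwDl.
have w1 : 0 < 1 + `|w| by rewrite ltr_pwDl.
move=> h; rewrite lt_min ltr_pdivlMr // => /andP[hr1 hr2].
have Gh : G (q + h *: w).
  apply: h2; rewrite addrAC subrr add0r normrZ; apply: le_lt_trans hr2.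
  by rewrite ler_wpM2l // lerDr.
have := h1 h hr1; rewrite add0r [h *: (1 : R)]mulr1 scale0r addr0.
by rewrite !g_xx_Amx.
Qed.

Lemma derive_hessian q w i j : G q -> w.1.1 = 0 ->
  is_derive q w ('D_(dx R j) ('D_(dx R i) g))
     ('D_(dxup q w) (Amx G g) (xup_of q) i j).
Proof.
move=> Gq w0; have := is_derive_entry i j (is_derive_hessian Gq w0).
by under eq_fun do rewrite mxE.
Qed.

Lemma continuous_xup_of q : G q -> {for q, continuous xup_of}.
Proof.
move=> Gq; have c1 : {for q, continuous (fun p : xyz R n => p.1.1)}.
  exact: (cvg_comp _ _ cvg_fst cvg_fst).
have c2 : {for q, continuous g} by exact/differentiable_continuous/diff_g.
have c3 : {for q, continuous (g_x g)}.
  by apply: continuous_row => i; apply: differentiable_continuous; exact: diff_Dg.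
exact: (cvg_pair (cvg_pair c1 c2) c3).
Qed.

Lemma dxup_sum (mu : R) (eta : 'rV[R]_n) :
  (0, mu, eta) = mu *: (0, 1, 0) + \sum_k eta 0 k *: dp R k :> xup R n.
Proof.
rewrite sum_dp; congr (_, _, _) => /=; rewrite ?scaler0 ?addr0 ?add0r //.
by rewrite [_ *: _]mulr1.
Qed.

Lemma derive_Amx (w : xup R n) (mu : R) (eta : 'rV[R]_n) i j : U G g w ->
  'D_(0, mu, eta) (Amx G g) w i j = mu * 'D_(0, 1, 0) (Amx G g) w i j
     + \sum_k eta 0 k * 'D_(dp R k) (Amx G g) w i j.
Proof.
move=> Uw; have [dA _] := hA Uw.
rewrite dxup_sum derive_dirD // derive_dirZ // derive_lincomb //.
rewrite !mxE summxE; congr (_ + _); apply: eq_bigr => k _; by rewrite mxE.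
Qed.

Lemma continuous_derive_Amx q v i j : G q ->
  {for q, continuous (fun q => 'D_v (Amx G g) (xup_of q) i j)}.
Proof.
move=> Gq; apply: continuous_entry.
have [_ /(_ v) /differentiable_continuous cA] := hA (U_xup_of Gq).
exact: (continuous_comp (continuous_xup_of Gq) cA).
Qed.

(** The direction [dxup p w] varies with [p], so it is expanded in fixed directions; along each of
    these the derivative of [A] is differentiable, hence continuous. *)
Lemma continuous_derive_hessian q w i j : G q -> w.1.1 = 0 ->
  {for q, continuous ('D_w ('D_(dx R j) ('D_(dx R i) g)))}.
Proof.
move=> Gq w0.
pose f p := 'D_w g p * 'D_(0, 1, 0) (Amx G g) (xup_of p) i j
  + \sum_k 'D_w ('D_(dx R k) g) p * 'D_(dp R k) (Amx G g) (xup_of p) i j.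
have fE p : G p -> 'D_w ('D_(dx R j) ('D_(dx R i) g)) p = f p.
  move=> Gp; have [_ ->] := derive_hessian i j Gp w0.
  rewrite derive_Amx; last exact: U_xup_of.
  by congr (_ + _); apply: eq_bigr => k _; rewrite mxE.
have cf : f p @[p --> q] --> f q.
  apply: cvgD.
    apply: cvgM; last exact: continuous_derive_Amx.
    exact: (differentiable_continuous (diff_Dg w Gq)).
  apply: cvg_sumr => k; apply: cvgM; last exact: continuous_derive_Amx.
  exact: continuous_DDg.
rewrite /prop_for /continuous_at (fE q Gq).
apply: cvg_trans cf; apply: near_eq_cvg.
have : nbhs q G by exact: open_nbhs_nbhs.
by apply: filterS => p Gp; rewrite -fE.
Qed.

(** A second-order expansion in [x] of ['D_w g], a function which is only known to be C^1: its
    quadratic coefficient is the derivative along [w] of the Hessian, expressed through [A]. *)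
Lemma transport_taylor q w eps : G q -> w.1.1 = 0 -> 0 < eps ->
  exists2 r, 0 < r & forall v : 'rV[R]_n, `|v| < r ->
   `|'D_w g (q + (v, 0, 0)) - 'D_w g q
      - \sum_i v 0 i * 'D_w ('D_(dx R i) g) q
      - 2^-1 * qf ('D_(dxup q w) (Amx G g) (xup_of q)) v v|
     <= eps * `|v| ^+ 2.
Proof.
move=> Gq w0 eps0.
have [||r r0 hr] := @taylor2_derive R _ G g q w n (fun i => dx R i) eps oG C2 Gq eps0.
- by move=> p Gp i j; have [] := derive_hessian i j Gp w0.
- by move=> i j; exact: continuous_derive_hessian.
exists r => // v /hr; rewrite sum_dx.
suff -> : \matrix_(i, j) 'D_w ('D_(dx R j) ('D_(dx R i) g)) q =
  'D_(dxup q w) (Amx G g) (xup_of q) by [].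
by apply/matrixP => i j; rewrite mxE; have [] := derive_hessian i j Gq w0.
Qed.

(** The expansion [transport_taylor] has the [w]-derivatives of g_x as its linear coefficients, and
    its other terms are at most [C] |h|^2, so these coefficients are the [x]-derivatives of
    ['D_w g]. *)
Lemma derive_comm q w i : G q -> w.1.1 = 0 ->
  'D_(dx R i) ('D_w g) q = 'D_w ('D_(dx R i) g) q.
Proof.
move=> Gq w0; set d := 'D_w ('D_(dx R i) g) q.
suff [] : is_derive q (dx R i) ('D_w g) d by [].
have [r r0 hr] := transport_taylor Gq w0 ltr01.
set N := 'D_(dxup q w) _ _ in hr.
pose C : R := 1 + n%:R * (n%:R * `|N|).
have C0 : 0 < C by rewrite ltr_pwDl // !mulr_ge0.
apply: is_derive_of_bound => e e0.
exists (Order.min r (e / C)); first by rewrite lt_min r0 divr_gt0.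
move=> h; rewrite lt_min => /andP[hr1]; rewrite ltr_pdivlMr // => hC.
pose v : 'rV[R]_n := h *: delta_mx 0 i.
have vh : `|v| <= `|h|.
  by rewrite normrZ ler_piMr //; exact: delta_mx_norm_le.
have := hr v (le_lt_trans vh hr1).
have -> : (v, 0, 0) = h *: dx R i :> xyz R n.
  by rewrite /dx; congr (_, _, _); rewrite /= scaler0.
have -> : \sum_k v 0 k * 'D_w ('D_(dx R k) g) q = h * d.
  rewrite (bigD1 i) //= big1 ?addr0; first by rewrite !mxE !eqxx /= mulr1.
  by move=> k ki; rewrite !mxE (negPf ki) /= mulr0 mul0r.
rewrite mul1r => hh.
have hq := @ler_norm_qf _ _ N v v `|N| (fun i j => mx_entry_le N i j).
have vv : `|v| * `|v| <= `|h| * `|h| by rewrite ler_pM.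
rewrite -(subrK (2^-1 * qf N v v) (_ - _ - _)).
apply: (le_trans (ler_normD _ _)).
apply: (@le_trans _ _ (`|v| ^+ 2 + n%:R * (n%:R * `|N|) * (`|v| * `|v|))).
  rewrite lerD // (le_trans _ hq) // normrM ler_piMl //.
  by rewrite ger0_norm ?invr_ge0 // invf_le1 // ler1n.
rewrite expr2 -{1}[`|v| * `|v|]mul1r -mulrDl -/C.
apply: (@le_trans _ _ (C * (`|h| * `|h|))); first by rewrite ler_pM2l.
by rewrite mulrA ler_wpM2r // mulrC ltW.
Qed.

End hessian.

(** * The structure equations *)

Lemma derive_comp_affine (R : realType) (U V W : normedModType R) (f : V -> W)
    (a : U -> V) (p v : U) (w : V) :
  (forall h : R, a (p + h *: v) = a p + h *: w) ->
  'D_v (fun t => f (a t)) p = 'D_w f (a p).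
Proof.
move=> ha; rewrite /derive.
suff -> : (fun h : R =>
    h^-1 *: (((fun t => f (a t)) \o shift p) (h *: v) - f (a p))) =
  (fun h => h^-1 *: ((f \o shift (a p)) (h *: w) - f (a p))) by [].
apply/funext => h /=.
by rewrite [h *: v + p]addrC ha [h *: w + _]addrC.
Qed.

Lemma differentiable_row (R : realType) (U : normedModType R) (n : nat)
    (f : 'I_n -> U -> R) (x : U) :
  (forall i, differentiable (f i) x) ->
  differentiable (fun t => \row_i f i t) x.
Proof.
move=> df.
have -> : (fun t => \row_i f i t) =
    \sum_i (fun t => f i t *: delta_mx 0 i : 'rV[R]_n).
  apply/funext => t; rewrite fct_sumE [LHS]row_sum_delta.
  by apply: eq_bigr => i _; rewrite mxE.
apply: differentiable_sum => i; exact: (differentiableZl (delta_mx 0 i) (df i)).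
Qed.

Lemma unitmx_inj (F : fieldType) (n : nat) (B : 'M[F]_n) :
  (forall v : 'rV_n, v *m B = 0 -> v = 0) -> B \in unitmx.
Proof.
move=> hB; rewrite -row_free_unit -kermx_eq0; apply/rowV0P => v /sub_kermxP.
exact: hB.
Qed.

Section structure_matrix.
Variables (R : realType) (n : nat) (G : set (xyz R n)) (g : xyz R n -> R).
Hypotheses (hg : generating_function G g) (hA1 : A1 G g) (hA2 : A2 G g).
Hypothesis hA : twice_differentiable_on (U G g) (Amx G g).

Lemma open_G : open G. Proof. by case: hg => -[]. Qed.

Lemma g_z_lt0 q : G q -> g_z g q < 0.
Proof. by case: hg => _ _ _ h /h. Qed.

Lemma g_z_neq0 q : G q -> g_z g q != 0.
Proof. by move=> /g_z_lt0 /lt_eqF ->. Qed.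

Lemma derive_yz (f : xyz R n -> R) q (a : 'rV[R]_n) b : differentiable f q ->
  'D_(0, a, b) f q = \sum_k a 0 k * 'D_(dy R k) f q + b * 'D_(dz R n) f q.
Proof.
move=> df; have -> : (0, a, b) = (0, a, 0) + b *: dz R n :> xyz R n.
  by rewrite /dz; congr (_, _, _); rewrite /= ?scaler0 ?addr0 // add0r [_ *: _]mulr1.
by rewrite derive_dirD // derive_dirZ // -sum_dy derive_lincomb.
Qed.

(** Eliminating [b] in favour of the derivative of [g] along (0, a, b) reveals the meaning of [E]:
    it governs the variation of g_x with [y] while the value of [g] is held fixed. *)
Lemma derive_g_x q (a : 'rV[R]_n) b : G q ->
  \row_i 'D_(0, a, b) ('D_(dx R i) g) q =
    a *m (Emx g q)^T + ('D_(0, a, b) g q / g_z g q) *: g_xz g q.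
Proof.
move=> Gq; have gz := g_z_neq0 Gq.
apply/rowP => i; rewrite !mxE derive_yz; last exact: (diff_Dg hg).
rewrite derive_yz; last exact: (diff_g hg).
rewrite -/(g_z g q) mulrDl mulfK // mulrDl addrA; congr (_ + _).
rewrite mulr_suml mulr_suml -big_split /=; apply: eq_bigr => k _.
rewrite !mxE big_ord1 !mxE.
move: (a 0 k) ('D_(dy R k) _ q) ((g_z g q)^-1) ('D_(dy R k) g q) => a1 a2 a3 a4.
by move: ('D_(dz R n) _ q) => a5; ring.
Qed.

Lemma Emx_unit q : G q -> Emx g q \in unitmx.
Proof. by move=> Gq; rewrite unitmxE unitfE hA2. Qed.

(** A2 lets [a] be solved from [eta] through the transpose of [E], and g_z <> 0 then determines the
    [b] that keeps [g] stationary. *)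
Lemma transport_exists q (eta : 'rV[R]_n) : G q -> exists a b,
  'D_(0, a, b) g q = 0 /\ \row_i 'D_(0, a, b) ('D_(dx R i) g) q = eta.
Proof.
move=> Gq; have gz := g_z_neq0 Gq.
pose a := eta *m invmx (Emx g q)^T.
pose b := - (\sum_k a 0 k * 'D_(dy R k) g q) / g_z g q.
have D0 : 'D_(0, a, b) g q = 0.
  rewrite derive_yz; last exact: (diff_g hg).
  by rewrite -/(g_z g q) /b mulfVK // subrr.
exists a, b; split=> //; rewrite derive_g_x // D0 mul0r scale0r addr0.
by rewrite /a mulmxKV // unitmx_tr Emx_unit.
Qed.

(** After the exchange of derivatives by [derive_comm], the matrix [E] reappears as the Jacobian of
    Q in [x], up to the factor -1/g_z. Thus A2 also makes Q locally invertible. *)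
Lemma derive_Q q (v : 'rV[R]_n) i : G q ->
  is_derive q (v, 0, 0) (fun p => Q g p 0 i)
    ((- (g_z g q)^-1 *: (v *m Emx g q)) 0 i).
Proof.
move=> Gq; have gz := g_z_neq0 Gq.
have -> : (fun p => Q g p 0 i) =
   (fun p => - ((g_z g p)^-1 * 'D_(dy R i) g p)).
  by apply/funext => p; rewrite !mxE.
have dv w : w.1.1 = 0 -> 'D_(v, 0, 0) ('D_w g) q
    = \sum_j v 0 j * 'D_w ('D_(dx R j) g) q.
  move=> w0; rewrite -sum_dx derive_lincomb; last exact: (diff_Dg hg).
  by apply: eq_bigr => j _; rewrite (derive_comm hg hA1 hA).
have d1 : is_derive q (v, 0, 0) (g_z g) ('D_(v, 0, 0) ('D_(dz R n) g) q).
  by apply/derivableP/diff_derivable/(diff_Dg hg).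
have d2 : is_derive q (v, 0, 0) ('D_(dy R i) g) ('D_(v, 0, 0) ('D_(dy R i) g) q).
  by apply/derivableP/diff_derivable/(diff_Dg hg).
have := dv (dz R n) erefl; set S1 := \sum_j _ => e1.
have := dv (dy R i) erefl; set S2 := \sum_j _ => e2.
have ES : (- (g_z g q)^-1 *: (v *m Emx g q)) 0 i =
    - ((g_z g q)^-1 * (S2 - (g_z g q)^-1 * 'D_(dy R i) g q * S1)).
  rewrite !mxE mulNr; congr (- (_ * _)).
  rewrite /S1 /S2 mulr_sumr -sumrB; apply: eq_bigr => j _.
  rewrite !mxE big_ord1 !mxE.
  move: (v 0 j) ('D_(dy R i) g q) ((g_z g q)^-1) => a1 a2 a3.
  by move: ('D_(dz R n) _ q) ('D_(dy R i) _ q) => a4 a5; ring.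
rewrite ES; rewrite {}e1 in d1; rewrite {}e2 in d2; clearbody S1 S2; clear ES.
have dinv : is_derive q (v, 0, 0) (fun p => (g_z g p)^-1)
    (- (g_z g q) ^- 2 *: S1).
  case: d1 => d1 e1; split; first exact: derivableV.
  by rewrite deriveV // e1.
apply: (is_derive_eq (is_deriveN (is_deriveM dinv d2))).
rewrite /GRing.scale /=.
move: (g_z g q) ('D_(dy R i) g q) gz => a1 a2 gz.
by field.
Qed.

Lemma differentiable_Q q : G q -> differentiable (Q g) q.
Proof.
move=> Gq; have gz := g_z_neq0 Gq.
have -> : Q g = fun p => \row_i (- ((g_z g p)^-1 * 'D_(dy R i) g p)).
  by apply/funext => p; apply/rowP => i; rewrite !mxE.
apply: differentiable_row => i; apply: differentiableN; apply: differentiableM.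
  by apply: differentiableV => //; exact: (diff_Dg hg).
exact: (diff_Dg hg).
Qed.

(** Local inversion of (y, z) |-> (g_x, g), with both pairs packed into rows of length [n + 1]: A1
    gives injectivity, A2 and g_z <> 0 the invertible differential. Openness in [p] allows
    identities valid on [U] to be differentiated in [p]. *)
Lemma U_open_slice (x : 'rV[R]_n) (u : R) (p : 'rV[R]_n) : U G g (x, u, p) ->
  exists2 r : R, 0 < r & forall p', `|p' - p| < r -> U G g (x, u, p').
Proof.
case=> y [z [/= Gq hu hp]].
pose q (s : 'rV[R]_(n + 1)) : xyz R n := (x, lsubmx s, rsubmx s 0 0).
pose f (k : 'I_(n + 1)) : xyz R n -> R :=
  match fintype.split k with inl i => 'D_(dx R i) g | inr _ => g end.
pose F (s : 'rV[R]_(n + 1)) := \row_k f k (q s).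
pose Om := [set s | G (q s)].
pose s0 : 'rV[R]_(n + 1) := row_mx y z%:M.
have qs0 : q s0 = (x, y, z) by rewrite /q /s0 row_mxKl row_mxKr mxE eqxx.
have dq s : differentiable q s.
  apply: differentiable_pair; last first.
    apply: (differentiable_comp (f := rsubmx) (g := fun M => M 0 0)).
      exact: differentiable_rsubmx.
    exact: differentiable_coord.
  apply: differentiable_pair; first exact: differentiable_cst.
  exact: differentiable_lsubmx.
have df k s : Om s -> differentiable (f k) (q s).
  by rewrite /f => Gs; case: splitP => *; [exact: (diff_Dg hg)|exact: (diff_g hg)].
have dF s : Om s -> differentiable F s.
  move=> Gs; apply: differentiable_row => k.
  by apply: (differentiable_comp (dq s)); exact: df.
have fl i : f (lshift 1 i) = 'D_(dx R i) g.
  have e : fintype.split (lshift 1 i) = inl i := unsplitK (inl i).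
  by rewrite /f e.
have fr i : f (rshift n i) = g.
  have e : fintype.split (rshift n i) = inr i := unsplitK (inr i).
  by rewrite /f e.
have F_inj : set_inj Om F.
  move=> s t; rewrite !inE => Gs Gt e.
  have ek k : f k (q s) = f k (q t).
    by have /(congr1 (fun m : 'rV_(n + 1) => m 0 k)) := e; rewrite !mxE.
  have : (lsubmx s, rsubmx s 0 0) = (lsubmx t, rsubmx t 0 0).
    apply: (hA1 (x := x)); rewrite ?inE //=; congr (_, _).
      apply/rowP => i; have := ek (lshift 1 i); rewrite fl => eki.
      by rewrite [LHS]mxE [RHS]mxE.
    by have := ek (rshift n 0); rewrite fr.
  move=> [el er]; rewrite -[s]hsubmxK -[t]hsubmxK el; congr row_mx.
  by apply/matrixP => i j; rewrite !ord1.
have Oo : open Om.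
  apply: open_comp open_G => s _; exact: differentiable_continuous.
have DF s v k : Om s ->
   ('D_v F s) 0 k = 'D_(0, lsubmx v, rsubmx v 0 0) (f k) (q s).
  move=> Gs; have dFs := @diff_derivable _ _ _ _ _ v (dF s Gs).
  rewrite derive_mx // mxE.
  have -> : (fun t => F t 0 k) = fun t => f k (q t).
    by apply/funext => t; rewrite mxE.
  apply: derive_comp_affine => h; rewrite /q !linearD !linearZ /= !mxE.
  by congr (_, _, _) => /=; rewrite scaler0 addr0.
have hB s : Om s -> lin1_mx ('d F s) \in unitmx /\
    forall v, 'D_v F s = v *m lin1_mx ('d F s).
  move=> Gs; have hD v : 'D_v F s = v *m lin1_mx ('d F s).
    by rewrite deriveE ?mul_rV_lin1 //; exact: dF.
  split=> //; apply: unitmx_inj => v; rewrite -hD => Dv0.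
  (* For [v] in the kernel [g] is stationary, so [derive_g_x] reduces to the [E] term and the [y]
     part of [v] vanishes; stationarity of [g] then kills the [z] part. *)
  have e1 : 'D_(0, lsubmx v, rsubmx v 0 0) g (q s) = 0.
    by rewrite -(fr 0) -DF // Dv0 mxE.
  have := derive_g_x (lsubmx v) (rsubmx v 0 0) Gs; rewrite e1 mul0r scale0r addr0.
  rewrite (_ : \row_i _ = 0); last first.
    by apply/rowP => i; rewrite [LHS]mxE [RHS]mxE -fl -DF // Dv0 mxE.
  move/(congr1 (mulmx^~ (invmx (Emx g (q s))^T))).
  rewrite mul0mx mulmxK ?unitmx_tr ?Emx_unit // => lv0.
  move: e1; rewrite -lv0 derive_yz; last exact: (diff_g hg).
  rewrite big1 ?add0r; last by move=> k _; rewrite mxE mul0r.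
  move/eqP; rewrite mulf_eq0 (negPf (g_z_neq0 Gs)) orbF => /eqP rv0.
  rewrite -[v]hsubmxK -lv0 [rsubmx v](_ : _ = 0) ?row_mx0 //.
  by apply/matrixP => i j; rewrite !ord1 rv0 mxE.
have Os0 : Om s0 by rewrite /Om /= qs0.
have [r r0 hr] := injective_open_map Oo F_inj dF hB Os0 ltr01.
exists r => // p' pp'.
have Fs0 : F s0 = row_mx p u%:M.
  apply/rowP => k; rewrite mxE qs0; case: (split_ordP k) => j ->.
    by rewrite fl row_mxEl hp mxE.
  by rewrite fr row_mxEr !ord1 mxE eqxx hu.
have [|s [_ Gs Fs]] := hr (row_mx p' u%:M).
  rewrite Fs0 opp_row_mx add_row_mx subrr.
  rewrite [ltLHS]/Num.Def.normr /= mx_normrE.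
  apply/bigmax_ltP; split => // -[i k] _ /=; rewrite (ord1 i).
  case: (split_ordP k) => j ->; last by rewrite row_mxEr mxE normr0.
  by rewrite row_mxEl (le_lt_trans (mx_entry_le _ _ _)).
exists (lsubmx s), (rsubmx s 0 0); split => //=.
  have /(congr1 (fun m : 'rV_(n + 1) => m 0 (rshift n 0))) := Fs.
  by rewrite mxE fr row_mxEr mxE eqxx mulr1n => <-.
apply/rowP => i; have /(congr1 (fun m : 'rV_(n + 1) => m 0 (lshift 1 i))) := Fs.
by rewrite mxE fl row_mxEl => <-; rewrite mxE.
Qed.

End structure_matrix.

(** * Condition A3w along segments *)

Definition dot (R : realType) (n : nat) (a b : 'rV[R]_n) : R :=
  \sum_i a 0 i * b 0 i.

Lemma qfDl (R : realType) (n : nat) (M : 'M[R]_n) (a a' b : 'rV[R]_n) (s : R) :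
  qf M (a + s *: a') b = qf M a b + s * qf M a' b.
Proof.
rewrite /qf mulr_sumr -big_split; apply: eq_bigr => i _ /=.
by rewrite mulr_sumr -big_split; apply: eq_bigr => j _ /=; rewrite !mxE; ring.
Qed.

Lemma qfDr (R : realType) (n : nat) (M : 'M[R]_n) (a b b' : 'rV[R]_n) (s : R) :
  qf M a (b + s *: b') = qf M a b + s * qf M a b'.
Proof.
rewrite /qf mulr_sumr -big_split; apply: eq_bigr => i _ /=.
by rewrite mulr_sumr -big_split; apply: eq_bigr => j _ /=; rewrite !mxE; ring.
Qed.

Lemma dot_gt0 (R : realType) (n : nat) (a : 'rV[R]_n) : a != 0 -> 0 < dot a a.
Proof.
move=> a0; rewrite lt_neqAle sumr_ge0 ?andbT; last first.
  by move=> i _; rewrite -expr2 sqr_ge0.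
apply: contra a0; rewrite eq_sym psumr_eq0; last first.
  by move=> i _; rewrite -expr2 sqr_ge0.
move=> /allP h; apply/eqP/rowP => i; rewrite mxE; apply/eqP.
by have := h i; rewrite mem_index_enum mulf_eq0 orbb => /(_ isT).
Qed.

(** Split [xi] into its part orthogonal to [eta], where the form is nonnegative, and [s *: eta];
    every remaining term contains the factor [s]. The two cross terms stay separate because [M] need
    not be symmetric. *)
Lemma qf_ortho_ge (R : realType) (n : nat) (M : 'M[R]_n) (xi eta : 'rV[R]_n)
    (s : R) :
  eta != 0 -> s = dot xi eta / dot eta eta ->
  (forall v, dot v eta = 0 -> 0 <= qf M v v) ->
  s * (qf M (xi - s *: eta) eta + qf M eta xi) <= qf M xi xi.
Proof.
move=> e0 sE hM; set v := xi - s *: eta.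
have vo : dot v eta = 0.
  have -> : dot v eta = dot xi eta - s * dot eta eta.
    rewrite /dot mulr_sumr -sumrB; apply: eq_bigr => i _.
    by rewrite !mxE mulrBl mulrA.
  by rewrite sE divfK ?subrr // gt_eqF // dot_gt0.
have xE : xi = v + s *: eta by rewrite /v subrK.
have E : qf M xi xi = qf M v v + s * (qf M v eta + qf M eta xi).
  by rewrite {1}xE qfDl {1}xE qfDr; ring.
by rewrite E lerDr; exact: hM.
Qed.

Lemma is_derive_qf (R : realType) (U : normedModType R) (n : nat)
    (M : U -> 'M[R]_n) (x v : U) (dM : 'M[R]_n) (a b : 'rV[R]_n) :
  is_derive x v M dM -> is_derive x v (fun t => qf (M t) a b) (qf dM a b).
Proof.
move=> d; apply: is_derive_sum_fun => i; apply: is_derive_sum_fun => j.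
have dij := is_derive_entry i j d.
have -> : (fun t => M t i j * (a 0 i * b 0 j)) =
    (a 0 i * b 0 j) *: (fun t => M t i j : R).
  by apply/funext => t; rewrite mulrC.
by rewrite [dM i j * _]mulrC; exact: is_deriveZ.
Qed.

Lemma is_derive_local (R : realType) (V W : normedModType R) (f h : V -> W)
    (w v : V) (d : W) (r : R) :
  0 < r -> (forall t : R, `|t| < r -> f (w + t *: v) = h (w + t *: v)) ->
  is_derive w v h d -> is_derive w v f d.
Proof.
move=> r0 fh dh; apply: is_derive_of_bound => e e0.
have [r1 r10 h1] := is_derive_bound dh e0.
exists (Order.min r r1); first by rewrite lt_min r0.
move=> t; rewrite lt_min => /andP[tr tr1]; rewrite fh //.
have := fh 0; rewrite scale0r addr0 normr0 => -> //; exact: h1.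
Qed.

Section a3w.
Variables (R : realType) (n : nat) (G : set (xyz R n)) (g : xyz R n -> R).
Hypotheses (hg : generating_function G g) (hA1 : A1 G g) (hA2 : A2 G g).
Hypothesis hA : twice_differentiable_on (U G g) (Amx G g).

Lemma derive_Amx_entry w v i j : U G g w ->
  'D_v (fun w' => Amx G g w' i j) w = 'D_v (Amx G g) w i j.
Proof.
move=> Uw; have [dA _] := hA Uw.
by have [] := is_derive_entry i j (derivableP (@diff_derivable _ _ _ _ _ v dA)).
Qed.

(** A3w differentiates entries, whereas the regularity hypothesis concerns the matrix. The two inner
    derivatives agree only on [U], so [U_open_slice] is needed before differentiating again. *)
Lemma derive2_Amx_entry w k l i j : U G g w ->
  'D_(dp R k) ('D_(dp R l) (fun w' => Amx G g w' i j)) w =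
  'D_(dp R k) ('D_(dp R l) (Amx G g)) w i j.
Proof.
case: w => -[x u] p Uw.
have [r r0 hr] := U_open_slice hg hA1 hA2 Uw.
have [_ /(_ (dp R l)) dA] := hA Uw.
have d := is_derive_entry i j (derivableP (@diff_derivable _ _ _ _ _ (dp R k) dA)).
suff : is_derive (x, u, p) (dp R k) ('D_(dp R l) (fun w' => Amx G g w' i j))
  ('D_(dp R k) ('D_(dp R l) (Amx G g)) (x, u, p) i j) by case.
apply: (is_derive_local r0 _ d) => t tr; apply: derive_Amx_entry.
have -> : (x, u, p) + t *: dp R k = (x, u, p + t *: delta_mx 0 k) :> xup R n.
  by congr (_, _, _); rewrite /= scaler0 addr0.
apply: hr; rewrite addrAC subrr add0r normrZ (le_lt_trans _ tr) //.
by rewrite ler_piMr //; exact: delta_mx_norm_le.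
Qed.

Lemma derive2_Amx_dir w (eta : 'rV[R]_n) i j : U G g w ->
  'D_(0, 0, eta) ('D_(0, 0, eta) (Amx G g)) w i j =
  \sum_k \sum_l eta 0 k * (eta 0 l * 'D_(dp R k) ('D_(dp R l) (Amx G g)) w i j).
Proof.
case: w => -[x u] p Uw.
have [r r0 hr] := U_open_slice hg hA1 hA2 Uw.
have [_ dA] := hA Uw.
pose v : xup R n := (0, 0, eta).
rewrite -/v; transitivity
    (\sum_k eta 0 k * 'D_(dp R k) ('D_v (Amx G g)) (x, u, p) i j).
  have := derive_lincomb (fun k => eta 0 k) (fun k => dp R k) (dA v).
  rewrite sum_dp -/v => ->; rewrite summxE.
  by apply: eq_bigr => k _; rewrite mxE.
apply: eq_bigr => k _; rewrite -mulr_sumr; congr (_ * _).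
have d l := is_derive_entry i j
  (derivableP (@diff_derivable _ _ _ _ _ (dp R k) (dA (dp R l)))).
have dS := is_derive_sum_fun (fun l => is_deriveZ (eta 0 l) (d l)).
have dv := is_derive_entry i j
  (derivableP (@diff_derivable _ _ _ _ _ (dp R k) (dA v))).
transitivity ('D_(dp R k) (fun w => 'D_v (Amx G g) w i j) (x, u, p)).
  by case: dv.
suff : is_derive (x, u, p) (dp R k) (fun w => 'D_v (Amx G g) w i j)
  (\sum_l eta 0 l * 'D_(dp R k) ('D_(dp R l) (Amx G g)) (x, u, p) i j) by case.
apply: (is_derive_local r0 _ dS) => t tr.
have -> : (x, u, p) + t *: dp R k = (x, u, p + t *: delta_mx 0 k) :> xup R n.
  by congr (_, _, _); rewrite /= scaler0 addr0.
have Uw' : U G g (x, u, p + t *: delta_mx 0 k).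
  apply: hr; rewrite addrAC subrr add0r normrZ (le_lt_trans _ tr) //.
  by rewrite ler_piMr //; exact: delta_mx_norm_le.
have := derive_Amx hA 0 eta i j Uw'; rewrite mul0r add0r => h.
by apply: (eq_trans h); apply: eq_bigr.
Qed.

(** By A3w the form t |-> A(x, u, p + t eta)(xi, xi) has nonnegative second derivative on [0, 1], so
    it lies above its tangent at 0. The mean value theorem is used twice, since the second
    derivatives of [A] need not be continuous. *)
Lemma A3w_segment (hA3w : A3w G g) x u (p eta xi : 'rV[R]_n) :
  (forall t : R, 0 <= t <= 1 -> U G g (x, u, p + t *: eta)) ->
  dot xi eta = 0 ->
  0 <= qf (Amx G g (x, u, p + eta) - Amx G g (x, u, p)
             - 'D_(0, 0, eta) (Amx G g) (x, u, p)) xi xi.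
Proof.
move=> hU ort; set v : xup R n := (0, 0, eta).
pose w0 : xup R n := (x, u, p).
have wE (t : R) : (x, u, p + t *: eta) = w0 + t *: v :> xup R n.
  by rewrite /w0 /v; congr (_, _, _) => /=; rewrite scaler0 addr0.
have Uw (t : R) : 0 <= t <= 1 -> U G g (w0 + t *: v).
  by move=> ht; rewrite -wE; exact: hU.
pose phi (t : R) := qf (Amx G g (w0 + t *: v)) xi xi.
pose phi' (t : R) := qf ('D_v (Amx G g) (w0 + t *: v)) xi xi.
pose phi'' (t : R) := qf ('D_v ('D_v (Amx G g)) (w0 + t *: v)) xi xi.
have d1 (t : R) : 0 <= t <= 1 -> is_derive t 1 phi (phi' t).
  move=> /Uw /hA [dA _]; apply: is_derive_qf; apply: is_derive_line.
  exact: diff_derivable.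
have d2 (t : R) : 0 <= t <= 1 -> is_derive t 1 phi' (phi'' t).
  move=> /Uw /hA [_ dA]; apply: is_derive_qf; apply: is_derive_line.
  exact: diff_derivable.
have phi''0 (t : R) : 0 <= t <= 1 -> 0 <= phi'' t.
  move=> /Uw Uwt.
  suff -> : phi'' t = \sum_i \sum_j \sum_k \sum_l
     'D_(dp R k) ('D_(dp R l) (fun w' => Amx G g w' i j)) (w0 + t *: v)
       * xi 0 i * xi 0 j * eta 0 k * eta 0 l by exact: hA3w.
  apply: eq_bigr => i _; apply: eq_bigr => j _.
  have h := derive2_Amx_dir eta i j Uwt.
  transitivity ((\sum_k \sum_l eta 0 k * (eta 0 l *
     'D_(dp R k) ('D_(dp R l) (Amx G g)) (w0 + t *: v) i j)) *
       (xi 0 i * xi 0 j)); first by congr (_ * _).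
  rewrite mulr_suml; apply: eq_bigr => k _; rewrite mulr_suml.
  apply: eq_bigr => l _.
  have h2 := derive2_Amx_entry k l i j Uwt.
  transitivity ('D_(dp R k) ('D_(dp R l) (Amx G g)) (w0 + t *: v) i j
     * xi 0 i * xi 0 j * eta 0 k * eta 0 l).
    have alg (a b c d e : R) : d * (e * a) * (b * c) = a * b * c * d * e.
      by ring.
    exact: alg.
  by congr (_ * _ * _ * _ * _).
have [c c01 e1] := mvt01 ler01 d1.
have /andP[c0 c1] := c01.
have [d d01 e2] : exists2 d, 0 <= d <= c & phi' c - phi' 0 = phi'' d * c.
  apply: mvt01 => // t /andP[t0 tc]; apply: d2.
  by rewrite t0 (le_trans tc).
have p1 : phi 1 = qf (Amx G g (x, u, p + eta)) xi xi.
  by rewrite /phi -wE scale1r.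
have w00 : w0 + (0 : R) *: v = w0 by rewrite scale0r addr0.
have p0 : phi 0 = qf (Amx G g (x, u, p)) xi xi :=
  congr1 (fun w => qf (Amx G g w) xi xi) w00.
have p0' : phi' 0 = qf ('D_v (Amx G g) (x, u, p)) xi xi :=
  congr1 (fun w => qf ('D_v (Amx G g) w) xi xi) w00.
suff h : 0 <= phi 1 - phi 0 - phi' 0 by rewrite !qfBl; rewrite p1 p0 p0' in h.
clear p1 p0 p0' d1 d2; clearbody phi phi' phi''.
rewrite e1 mulr1 e2 mulr_ge0 //; apply: phi''0.
by case/andP: d01 => -> /le_trans ->.
Qed.

End a3w.

(** * Second-order conditions at a touching point *)

Definition small2 (R : realType) (f : R -> R) : Prop :=
  forall e : R, 0 < e -> exists2 r : R, 0 < r &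
    forall h : R, `|h| < r -> `|f h| <= e * h ^+ 2.

Lemma small2_cvg (R : realType) (f : R -> R) : small2 f ->
  f h / h ^+ 2 @[h --> 0^'] --> 0.
Proof.
move=> hf; apply/cvgrPdist_le => e e0; have [r r0 hr] := hf e e0.
apply/nbhs_ballP; exists r => //= h; rewrite /ball /= sub0r normrN => hh h0.
rewrite sub0r normrN normrM normfV (ger0_norm (sqr_ge0 h)) ler_pdivrMr.
  exact: hr.
by rewrite exprn_even_gt0.
Qed.

Lemma curve_lipschitz (R : realType) (V : normedModType R) (c : R -> V)
    (t0 : R) (xi : V) : is_derive t0 1 c xi ->
  exists2 r : R, 0 < r & forall h : R, `|h| < r ->
    `|c (t0 + h) - c t0| <= (`|xi| + 1) * `|h|.
Proof.
move=> dc; have [r r0 hr] := is_derive_bound dc ltr01.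
exists r => // h /hr; rewrite [h *: (1 : R)]mulr1 mul1r => hh.
rewrite -(subrK (h *: xi) (_ - _)) (le_trans (ler_normD _ _)) //.
by rewrite normrZ mulrDl mul1r addrC lerD // mulrC.
Qed.

Lemma small2_comp (R : realType) (V : normedModType R) (rho : V -> R)
    (c : R -> V) (t0 : R) (xi : V) :
  (forall e, 0 < e -> exists2 r : R, 0 < r &
     forall v, `|v| < r -> `|rho v| <= e * `|v| ^+ 2) ->
  is_derive t0 1 c xi -> small2 (fun h => rho (c (t0 + h) - c t0)).
Proof.
move=> hrho dc e e0; have [r1 r10 h1] := curve_lipschitz dc.
set C := `|xi| + 1 in h1.
have C0 : 0 < C by rewrite ltr_wpDl.
have [r2 r20 h2] := hrho (e / C ^+ 2) (divr_gt0 e0 (exprn_gt0 _ C0)).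
exists (Order.min r1 (r2 / C)); first by rewrite lt_min r10 divr_gt0.
move=> h; rewrite lt_min ltr_pdivlMr // => /andP[/h1 hv hh].
apply: (le_trans (h2 _ _)); first by rewrite (le_lt_trans hv) // mulrC.
rewrite mulrAC ler_pdivrMr ?exprn_gt0 // -mulrA ler_pM2l //.
rewrite -[h ^+ 2]real_normK ?num_real // -exprMn lerXn2r ?nnegrE //.
  by rewrite mulr_ge0 // ltW.
by rewrite mulrC.
Qed.

Lemma derive_quotient_cvg (R : realType) (V : normedModType R) (c : R -> V)
    (t0 : R) (xi : V) : is_derive t0 1 c xi ->
  h^-1 *: (c (t0 + h) - c t0) @[h --> 0^'] --> xi.
Proof.
move=> [/cvg_ex [l cl] <-].
have e : (fun h => h^-1 *: ((c \o shift t0) (h *: 1) - c t0)) =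
  (fun h : R => h^-1 *: (c (t0 + h) - c t0)).
  by apply/funext => h /=; rewrite [h *: (1 : R)]mulr1 [h + t0]addrC.
by rewrite /derive e; rewrite e in cl; rewrite (cvg_lim _ cl).
Qed.

(** [K] is bounded near 0, so for small h of either sign the linear term dominates unless [al] = 0;
    division by h^2 then gives the sign of [ka]. *)
Lemma touching_signs (R : realType) (al ka r : R) (K : R -> R) :
  0 < r -> (forall h : R, h != 0 -> `|h| < r -> h * al + h ^+ 2 * K h <= 0) ->
  K h @[h --> 0^'] --> ka -> al = 0 /\ ka <= 0.
Proof.
move=> r0 hK cK.
have Kb (e : R) : 0 < e -> exists2 s, 0 < s & forall h : R, h != 0 -> `|h| < s ->
    `|ka - K h| <= e.
  move=> e0; have /cvgrPdist_le /(_ e e0) /nbhs_ballP [s s0 hs] := cK.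
  by exists s => // h h0 hh; apply: hs => //; rewrite -ball_normE /= sub0r normrN.
have key (sg : R) : `|sg| = 1 -> sg * al <= 0.
  move=> s1; rewrite leNgt; apply/negP => al0.
  have [s s0 hs] := Kb 1 ltr01.
  pose B := `|ka| + 1.
  have B0 : 0 < B by rewrite ltr_wpDl.
  pose t := Order.min (Order.min r s) (sg * al / B) / 2.
  have m0 : 0 < Order.min (Order.min r s) (sg * al / B).
    by rewrite !lt_min r0 s0 divr_gt0.
  have t0 : 0 < t by rewrite divr_gt0.
  have : t < Order.min (Order.min r s) (sg * al / B) by rewrite /t; lra.
  rewrite !lt_min ltr_pdivlMr // => /andP[/andP[tr ts] tB].
  have h0 : t * sg != 0.
    by rewrite mulf_neq0 ?(gt_eqF t0) // -normr_eq0 s1 oner_neq0.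
  have hn : `|t * sg| = t by rewrite normrM s1 mulr1 gtr0_norm.
  have := hK (t * sg) h0; rewrite hn => /(_ tr).
  have := hs (t * sg) h0; rewrite hn => /(_ ts).
  have sg2 : sg ^+ 2 = 1 by rewrite -real_normK ?num_real // s1 expr1n.
  set k := K _ => hk.
  have -> : t * sg * al + (t * sg) ^+ 2 * k = t * (sg * al + t * k).
    by rewrite exprMn sg2; ring.
  rewrite pmulr_rle0 //.
  have kB : - B <= k.
    have := ler_normB (ka - k) ka; rewrite addrAC subrr add0r normrN => hB.
    have := ler_norm (- k); rewrite normrN /B; lra.
  nra.
have al0 : al = 0.
  have := key 1 (normr1 _); have := key (-1) (normrN1 _); lra.
split=> //; rewrite leNgt; apply/negP => ka0.
have [s s0 hs] := Kb (ka / 2) (divr_gt0 ka0 (ltr0n _ 2)).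
pose t := Order.min r s / 2.
have m0 : 0 < Order.min r s by rewrite lt_min r0.
have t0 : 0 < t by rewrite divr_gt0.
have : t < Order.min r s by rewrite /t; lra.
rewrite lt_min => /andP[tr ts].
have tn0 : t != 0 by rewrite gt_eqF.
have := hK t tn0; rewrite gtr0_norm // => /(_ tr).
have := hs t tn0; rewrite gtr0_norm // => /(_ ts).
rewrite al0 mulr0 add0r pmulr_rle0 ?exprn_gt0 // => /ler_normlP [].
lra.
Qed.

Lemma parabola_le (R : realType) (m M h : R) : `|h| < 1 ->
  `|m * (h + M / 4 * h ^+ 2)| <= (`|m| * (1 + `|M|) + 1) * `|h|.
Proof.
move=> hh; rewrite normrM.
have -> : h + M / 4 * h ^+ 2 = h * (1 + M / 4 * h) by ring.
rewrite normrM mulrCA mulrC ler_wpM2r //.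
apply: (@le_trans _ _ (`|m| * (1 + `|M|))); last by rewrite lerDl.
rewrite ler_wpM2l // (le_trans (ler_normD _ _)) // normr1 lerD2l.
rewrite !normrM -mulrA ler_piMr // mulr_ile1 // ?(ltW hh) //.
by rewrite normfV invf_le1 ger0_norm // ler1n.
Qed.

Lemma touching_reorder (R : realType) (x y z x' y' : R) :
  0 - 0 - 0 - x - y + z + x' + y' <= 0 -> - y - x + z + x' + y' <= 0.
Proof. lra. Qed.

(** Here [A1], [A2], [A3] are values of [g] on the touching curve, at (c, y1, z1) and at (c, y0,
    z0); [v1], [v0] are the linear and [x1], [x0] the quadratic Taylor terms of the last two. The
    difference [v1 - v0] is eliminated through the expansion of l, whose value is
    [h * (k0 * (gz0 + h * d0))] and whose quadratic term is [xa]. *)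
Lemma touching_algebra (R : realType)
    (h m M gz1 gz0 k0 A1 A2 A3 G0 d0 d1 Z v1 v0 x1 x0 xa q : R) :
  let om := - (m * (h + M / 4 * h ^+ 2)) in
  h != 0 -> h ^+ 2 * q = x1 - x0 - xa ->
  A1 - A3 = h * (- m * gz1 + k0 * gz0) +
   h ^+ 2 * ((A1 - A2 - om * (gz1 + h * d1) - 2^-1 * (om ^+ 2 * Z)) / h ^+ 2 +
     (A2 - G0 - v1 - 2^-1 * x1) / h ^+ 2 - (A3 - G0 - v0 - 2^-1 * x0) / h ^+ 2 -
     (h * (k0 * (gz0 + h * d0)) - 0 - (v1 - v0) - 2^-1 * xa) / h ^+ 2 -
     m * M / 4 * gz1 - m * (1 + M / 4 * h) * d1 +
     2^-1 * (m ^+ 2 * ((1 + M / 4 * h) * (1 + M / 4 * h)) * Z) +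
     k0 * d0 + 2^-1 * q).
Proof.
move=> om h0 hq; have -> : x1 = h ^+ 2 * q + x0 + xa by rewrite hq; ring.
by rewrite /om; field.
Qed.

Lemma dotBr (R : realType) (n : nat) (v a b : 'rV[R]_n) :
  dot v (a - b) = dot v a - dot v b.
Proof.
by rewrite /dot -sumrB; apply: eq_bigr => i _; rewrite !mxE mulrBr.
Qed.

Lemma qfZ (R : realType) (n : nat) (M : 'M[R]_n) (a b : 'rV[R]_n) (s : R) :
  qf M (s *: a) (s *: b) = s ^+ 2 * qf M a b.
Proof.
rewrite /qf mulr_sumr; apply: eq_bigr => i _; rewrite mulr_sumr.
by apply: eq_bigr => j _; rewrite !mxE; ring.
Qed.

Section touching.
Variables (R : realType) (n : nat) (G : set (xyz R n)) (g : xyz R n -> R).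
Hypotheses (hg : generating_function G g) (hA1 : A1 G g) (hA2 : A2 G g).
Hypothesis hA : twice_differentiable_on (U G g) (Amx G g).

Let C2 : C2_on G g. Proof. by case: hg. Qed.

Lemma taylor2_x q eps : G q -> 0 < eps ->
  exists2 r : R, 0 < r & forall v : 'rV[R]_n, `|v| < r ->
   `|g (q + (v, 0, 0)) - g q - dot v (g_x g q) - 2^-1 * qf (g_xx g q) v v|
     <= eps * `|v| ^+ 2.
Proof.
move=> Gq eps0.
have [r r0 hr] := taylor2 (fun i => dx R i) (open_G hg) C2 Gq eps0.
exists r => // v hv; have := hr q v; rewrite subrr normr0 => /(_ r0 hv).
rewrite sum_dx.
have -> : \sum_i v 0 i * 'D_(dx R i) g q = dot v (g_x g q).
  by apply: eq_bigr => i _; rewrite mxE.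
by [].
Qed.

Lemma taylor2_z q eps : G q -> 0 < eps ->
  exists2 r : R, 0 < r & forall p (s : R), `|p - q| < r -> `|s| < r ->
   `|g (p + (0, 0, s)) - g p - s * g_z g p
      - 2^-1 * (s ^+ 2 * 'D_(dz R n) (g_z g) q)| <= eps * s ^+ 2.
Proof.
move=> Gq eps0.
have [r r0 hr] := taylor2 (fun i : 'I_1 => dz R n) (open_G hg) C2 Gq eps0.
exists r => // p s pq hs.
have sn : `|(s%:M : 'rV[R]_1)| = `|s|.
  apply/eqP; rewrite eq_le; apply/andP; split; last first.
    by have := mx_entry_le (s%:M : 'rV[R]_1) 0 0; rewrite mxE eqxx.
  rewrite [leLHS]/Num.Def.normr /= mx_normrE; apply/bigmax_leP.
  by split => // -[i j] _ /=; rewrite !ord1 mxE eqxx.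
have := hr p s%:M pq; rewrite sn => /(_ hs).
rewrite !big_ord1 mxE eqxx mulr1n.
have -> : s *: dz R n = (0, 0, s).
  by rewrite /dz; congr (_, _, _); rewrite /= ?scaler0 // [_ *: _]mulr1.
have -> : qf (\matrix_(i, j) 'D_(dz R n) ('D_(dz R n) g) q) s%:M s%:M
   = s ^+ 2 * 'D_(dz R n) (g_z g) q.
  by rewrite /qf !big_ord1 !mxE eqxx mulr1n mulrC expr2.
by rewrite real_normK ?num_real.
Qed.

Lemma shift_xE (q : xyz R n) (x : 'rV[R]_n) :
  q + (x - q.1.1, 0, 0) = (x, q.1.2, q.2).
Proof. by case: q => -[a b] d; congr (_, _, _); rewrite /= ?addr0 // subrKC. Qed.

Lemma small2_taylor_x q (c : R -> 'rV[R]_n) (t0 : R)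
    (xi : 'rV[R]_n) :
  G q -> c t0 = q.1.1 ->
  is_derive t0 1 c xi ->
  small2 (fun h => g (c (t0 + h), q.1.2, q.2) - g q
     - dot (c (t0 + h) - q.1.1) (g_x g q)
     - 2^-1 * qf (g_xx g q) (c (t0 + h) - q.1.1) (c (t0 + h) - q.1.1)).
Proof.
move=> Gq c0 dc.
pose rho v := g (q + (v, 0, 0)) - g q - dot v (g_x g q)
  - 2^-1 * qf (g_xx g q) v v.
have := @small2_comp _ _ rho c t0 xi (fun e => taylor2_x Gq (eps := e)) dc.
by rewrite /rho c0; under eq_fun do rewrite shift_xE.
Qed.

Lemma small2_transport q w (c : R -> 'rV[R]_n) (t0 : R)
    (xi : 'rV[R]_n) :
  G q -> w.1.1 = 0 ->
  c t0 = q.1.1 -> is_derive t0 1 c xi ->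
  small2 (fun h => 'D_w g (c (t0 + h), q.1.2, q.2) - 'D_w g q
     - dot (c (t0 + h) - q.1.1) (\row_i 'D_w ('D_(dx R i) g) q)
     - 2^-1 * qf ('D_(dxup g q w) (Amx G g) (xup_of g q))
                (c (t0 + h) - q.1.1) (c (t0 + h) - q.1.1)).
Proof.
move=> Gq w0 c0 dc.
set et := \row_i _.
pose rho v := 'D_w g (q + (v, 0, 0)) - 'D_w g q - dot v et
  - 2^-1 * qf ('D_(dxup g q w) (Amx G g) (xup_of g q)) v v.
have hrho e : 0 < e -> exists2 r : R, 0 < r &
    forall v, `|v| < r -> `|rho v| <= e * `|v| ^+ 2.
  move=> e0; have [r r0 hr] := transport_taylor hg hA1 hA Gq w0 e0.
  exists r => // v /hr; rewrite /rho.
  suff -> : dot v et = \sum_i v 0 i * 'D_w ('D_(dx R i) g) q by [].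
  by apply: eq_bigr => i _; rewrite [et _ _]mxE.
have := small2_comp hrho dc.
by rewrite /rho c0; under eq_fun do rewrite shift_xE.
Qed.

Lemma small2_taylor_z q (c : R -> 'rV[R]_n) (t0 : R)
    (xi : 'rV[R]_n) (om : R -> R) C :
  G q ->
  c t0 = q.1.1 -> is_derive t0 1 c xi -> 0 < C ->
  (forall h : R, `|h| < 1 -> `|om h| <= C * `|h|) ->
  small2 (fun h => g (c (t0 + h), q.1.2, q.2 + om h) - g (c (t0 + h), q.1.2, q.2)
     - om h * g_z g (c (t0 + h), q.1.2, q.2)
     - 2^-1 * (om h ^+ 2 * 'D_(dz R n) (g_z g) q)).
Proof.
move=> Gq c0 dc C0 hom e e0.
have [r1 r10 h1] := curve_lipschitz dc; set C1 := `|xi| + 1 in h1.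
have C10 : 0 < C1 by rewrite ltr_wpDl.
have [r2 r20 h2] := taylor2_z Gq (divr_gt0 e0 (exprn_gt0 2 C0)).
exists (Order.min (Order.min r1 1) (Order.min (r2 / C1) (r2 / C))).
  by rewrite !lt_min r10 ltr01 !divr_gt0.
move=> h; rewrite !lt_min !ltr_pdivlMr // => /andP[/andP[/h1 hv hh1] /andP[hr1 hr2]].
have ho := hom h hh1.
have pE : (c (t0 + h), q.1.2, q.2 + om h) =
    (c (t0 + h), q.1.2, q.2) + (0, 0, om h) :> xyz R n.
  by congr (_, _, _); rewrite /= addr0.
rewrite pE; apply: (le_trans (h2 _ _ _ _)).
- have -> : (c (t0 + h), q.1.2, q.2) - q = (c (t0 + h) - c t0, 0, 0) :> xyz R n.
    by rewrite c0; case: (q) => -[? ?] ?; congr (_, _, _); rewrite /= subrr.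
  rewrite !prod_normE /= !normr0 !(max_l (normr_ge0 _)) (le_lt_trans hv) //.
  by rewrite mulrC.
- by rewrite (le_lt_trans ho) // mulrC.
rewrite mulrAC ler_pdivrMr ?exprn_gt0 // -mulrA ler_pM2l //.
rewrite -[h ^+ 2]real_normK ?num_real // -exprMn -[om h ^+ 2]real_normK ?num_real //.
rewrite lerXn2r ?nnegrE //; first by rewrite mulr_ge0 // ltW.
by rewrite mulrC.
Qed.

Lemma is_derive_lift (y : 'rV[R]_n) (z : R) (c : R -> 'rV[R]_n) (t0 : R)
    (xi : 'rV[R]_n) :
  is_derive t0 1 c xi -> is_derive t0 1 (fun t : R => (c t, y, z) : xyz R n) (xi, 0, 0).
Proof. by move=> dc; apply: is_derive_pair; apply: is_derive_pair. Qed.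

Lemma transport_affine q (b : 'rV[R]_n) (s : R) : G q ->
  'D_(0, b, s) g q = g_z g q * (s - dot (Q g q) b).
Proof.
move=> Gq; have gz := g_z_neq0 hg Gq.
rewrite derive_yz; last exact: (diff_g hg).
rewrite mulrBr -/(g_z g q) addrC [s * _]mulrC; congr (_ + _).
rewrite /dot mulr_sumr -sumrN; apply: eq_bigr => k _; rewrite !mxE.
move: ('D_(dy R k) g q) (b 0 k) (g_z g q) gz => a1 a2 a3 gz.
by field.
Qed.

(** The touching curve in [z] has slope -m, and bending [M / 4] where the exponential would give
    [M / 2]: a polynomial bound for the exponential, valid on a whole interval, is what gets applied
    later. *)
Lemma touching_second_order (q0 q1 : xyz R n) (c : R -> 'rV[R]_n)
    (t0 r0 m M : R) (xi D : 'rV[R]_n) :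
  G q0 -> G q1 -> c t0 = q0.1.1 -> c t0 = q1.1.1 -> g q1 = g q0 ->
  is_derive t0 1 c xi -> 0 < r0 ->
  (forall h : R, `|h| < r0 -> Q g (c (t0 + h), q0.1.2, q0.2) = Q g q0 + h *: D) ->
  (forall h : R, `|h| < r0 ->
     g (c (t0 + h), q1.1.2, q1.2 - m * (h + M / 4 * h ^+ 2))
       <= g (c (t0 + h), q0.1.2, q0.2)) ->
  let eta := g_x g q1 - g_x g q0 in
  let N := g_xx g q1 - g_xx g q0
             - 'D_(0, 0, eta) (Amx G g) (xup_of g q0) in
  dot xi eta = m * g_z g q1 /\
  - m * 'D_(xi, 0, 0) (g_z g) q1 - m * M / 4 * g_z g q1
    + 2^-1 * (m ^+ 2 * 'D_(dz R n) (g_z g) q1)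
    + dot xi eta / g_z g q0 * 'D_(xi, 0, 0) (g_z g) q0
    + 2^-1 * qf N xi xi <= 0.
Proof.
move=> Gq0 Gq1 c0 c1 gE dc r00 hQ hT eta N.
have [b [s [l0 lx]]] := transport_exists hg hA2 eta Gq0.
pose w : xyz R n := (0, b, s).
have dxw : dxup g q0 w = (0, 0, eta) by rewrite /dxup l0 lx.
pose p0 h := (c (t0 + h), q0.1.2, q0.2) : xyz R n.
pose p1 h := (c (t0 + h), q1.1.2, q1.2) : xyz R n.
have gz0 := g_z_neq0 hg Gq0; have gz1 := g_z_neq0 hg Gq1.
have p00 : (c t0, q0.1.2, q0.2) = q0 by rewrite c0; case: (q0) => -[].
have p10 : (c t0, q1.1.2, q1.2) = q1 by rewrite c1; case: (q1) => -[].
have dl0 := is_derive_lift q0.1.2 q0.2 dc.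
have dl1 := is_derive_lift q1.1.2 q1.2 dc.
have [r1 r10 h1] : exists2 r1 : R, 0 < r1 & forall h : R, `|h| < r1 -> G (p0 h).
  have [ra ra0 ha] := open_norm (open_G hg) Gq0.
  have [rb rb0 hb] := curve_lipschitz dl0.
  set C := `|_| + 1 in hb; have C0 : 0 < C by rewrite ltr_wpDl.
  exists (Order.min rb (ra / C)); first by rewrite lt_min rb0 divr_gt0.
  move=> h; rewrite lt_min ltr_pdivlMr // => /andP[/hb hb' hh].
  by apply: ha; rewrite -p00 (le_lt_trans hb') // mulrC.
(* The slope of l / g_z along the curve: this quotient is affine in Q and vanishes at [q0]. *)
pose k0 := - dot D b.
have lE (h : R) : `|h| < r0 -> `|h| < r1 -> 'D_w g (p0 h) = h * (k0 * g_z g (p0 h)).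
  move=> hr0 hr1; rewrite /w transport_affine; last exact: h1.
  have := transport_affine b s Gq0; rewrite l0 => /esym/eqP.
  rewrite mulf_eq0 (negPf gz0) /= subr_eq0 => /eqP sE.
  rewrite /p0 hQ //.
  have -> : dot (Q g q0 + h *: D) b = s + h * dot D b.
    rewrite sE /dot mulr_sumr -big_split; apply: eq_bigr => i _ /=.
    by rewrite [X in X * _]mxE [X in (_ + X) * _]mxE; ring.
  by rewrite /k0; move: (g_z g _) => a1; ring.
have dgz q y z : (c t0, y, z) = q -> G q ->
    is_derive t0 1 (fun t => g_z g (c t, y, z)) ('D_(xi, 0, 0) (g_z g) q).
  move=> <- Gq; apply: (is_derive_comp_curve (f := g_z g)).
    exact: (diff_Dg hg).
  exact: is_derive_lift.
pose d0 h := h^-1 *: (g_z g (p0 h) - g_z g q0).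
pose d1 h := h^-1 *: (g_z g (p1 h) - g_z g q1).
have cd0 : d0 h @[h --> 0^'] --> 'D_(xi, 0, 0) (g_z g) q0.
  by have := derive_quotient_cvg (dgz _ _ _ p00 Gq0); rewrite p00.
have cd1 : d1 h @[h --> 0^'] --> 'D_(xi, 0, 0) (g_z g) q1.
  by have := derive_quotient_cvg (dgz _ _ _ p10 Gq1); rewrite p10.
have d0E (h : R) : h != 0 -> g_z g (p0 h) = g_z g q0 + h * d0 h.
  by move=> h0; rewrite /d0 /GRing.scale /= mulVKf // subrKC.
have d1E (h : R) : h != 0 -> g_z g (p1 h) = g_z g q1 + h * d1 h.
  by move=> h0; rewrite /d1 /GRing.scale /= mulVKf // subrKC.
have cid : h @[h --> 0^'] --> (0 : R) by exact: nbhs_dnbhs.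
(* The derivative of l o c at [t0] computed twice: by the chain rule, where the gradient of l is
   [eta], and from the exact formula [lE]. *)
have xe : dot xi eta = k0 * g_z g q0.
  have Dl : is_derive t0 1 (fun t => 'D_w g (c t, q0.1.2, q0.2)) (dot xi eta).
    have : is_derive t0 1 (fun t => 'D_w g (c t, q0.1.2, q0.2))
        ('D_(xi, 0, 0) ('D_w g) (c t0, q0.1.2, q0.2)).
      have dw : differentiable ('D_w g) (c t0, q0.1.2, q0.2).
        by apply: (diff_Dg hg); rewrite p00.
      exact: (is_derive_comp_curve dw dl0).
    rewrite p00 -sum_dx derive_lincomb; last exact: (diff_Dg hg).
    suff -> : \sum_i xi 0 i *: 'D_(dx R i) ('D_w g) q0 = dot xi eta by [].
    apply: eq_bigr => i _; rewrite (derive_comm hg hA1 hA i Gq0) //.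
    by rewrite -lx mxE.
  have l1 := derive_quotient_cvg Dl; rewrite p00 l0 in l1.
  have l2 : k0 * (g_z g q0 + h * d0 h) @[h --> 0^'] -->
      k0 * (g_z g q0 + 0 * 'D_(xi, 0, 0) (g_z g) q0).
    apply: cvgM; first exact: cvg_cst.
    apply: cvgD; first exact: cvg_cst.
    exact: (cvgM cid cd0).
  rewrite mul0r addr0 in l2; apply: (cvg_unique _ _ l2) => //.
  apply: cvg_trans l1; apply: near_eq_cvg.
  apply/nbhs_ballP; exists (Order.min r0 r1); first by rewrite /= lt_min r00.
  move=> h; rewrite -ball_normE /= sub0r normrN lt_min => /andP[hr0 hr1] h0.
  by rewrite subr0 (lE h hr0 hr1) d0E // /GRing.scale /= mulKf.
pose om h := - (m * (h + M / 4 * h ^+ 2)).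
have hom (h : R) : `|h| < 1 -> `|om h| <= (`|m| * (1 + `|M|) + 1) * `|h|.
  by move=> hh; rewrite /om normrN parabola_le.
have C0 : 0 < `|m| * (1 + `|M|) + 1 by rewrite ltr_wpDl // mulr_ge0 // addr_ge0.
pose v h := c (t0 + h) - q0.1.1.
have q11 : q1.1.1 = q0.1.1 by rewrite -c0 c1.
have s1 := small2_cvg (small2_taylor_z Gq1 c1 dc C0 hom).
have s2 := small2_cvg (small2_taylor_x Gq1 c1 dc).
have s3 := small2_cvg (small2_taylor_x Gq0 c0 dc).
have s4 := small2_cvg (small2_transport Gq0 (erefl : w.1.1 = 0) c0 dc).
rewrite q11 in s2; rewrite l0 lx dxw in s4.
move: s1 s2 s3 s4.
set P1 := (X in X h / _ @[h --> _] --> _).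
set P2 := (X in _ -> X h / _ @[h --> _] --> _ -> _).
set P3 := (X in _ -> _ -> X h / _ @[h --> _] --> _ -> _).
set P4 := (X in _ -> _ -> _ -> X h / _ @[h --> _] --> _ -> _).
move=> s1 s2 s3 s4.
pose u h := h^-1 *: v h.
have cu i : u h 0 i @[h --> 0^'] --> xi 0 i.
  have e : (fun h => u h 0 i) = (fun h => h^-1 *: (c (t0 + h) 0 i - c t0 0 i)).
    by apply/funext => h; rewrite /u /v -c0 !mxE.
  by rewrite e; exact: (derive_quotient_cvg (is_derive_entry 0 i dc)).
have cqf : qf N (u h) (u h) @[h --> 0^'] --> qf N xi xi.
  apply: cvg_sumr => i; apply: cvg_sumr => j.
  apply: cvgM; first exact: cvg_cst.
  exact: (cvgM (cu i) (cu j)).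
have uE (h : R) : h != 0 -> qf N (v h) (v h) = h ^+ 2 * qf N (u h) (u h).
  move=> h0; have -> : v h = h *: u h by rewrite /u scalerA divff // scale1r.
  exact: qfZ.
have vE (h : R) : dot (v h) eta = dot (v h) (g_x g q1) - dot (v h) (g_x g q0).
  exact: dotBr.
have NE (h : R) : qf N (v h) (v h) = qf (g_xx g q1) (v h) (v h)
   - qf (g_xx g q0) (v h) (v h)
   - qf ('D_(0, 0, eta) (Amx G g) (xup_of g q0)) (v h) (v h).
  by rewrite /N !qfBl.
pose gzz := 'D_(dz R n) (g_z g) q1.
(* The second-order quotient of the difference at the touching point: the four remainders tend to 0,
   and every other piece has a limit that uses only first derivatives of [c]. *)
pose K (h : R) := P1 h / h ^+ 2 + P2 h / h ^+ 2 - P3 h / h ^+ 2 - P4 h / h ^+ 2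
  - m * M / 4 * g_z g q1 - m * (1 + M / 4 * h) * d1 h
  + 2^-1 * (m ^+ 2 * ((1 + M / 4 * h) * (1 + M / 4 * h)) * gzz)
  + k0 * d0 h + 2^-1 * qf N (u h) (u h).
have cl : 1 + M / 4 * h @[h --> 0^'] --> 1 + M / 4 * 0.
  apply: cvgD; first exact: cvg_cst.
  by apply: cvgM; first exact: cvg_cst.
have cK : K h @[h --> 0^'] --> 0 + 0 - 0 - 0
  - m * M / 4 * g_z g q1 - m * (1 + M / 4 * 0) * 'D_(xi, 0, 0) (g_z g) q1
  + 2^-1 * (m ^+ 2 * ((1 + M / 4 * 0) * (1 + M / 4 * 0)) * gzz)
  + k0 * 'D_(xi, 0, 0) (g_z g) q0 + 2^-1 * qf N xi xi.
  apply: cvgD; last by apply: cvgM; [exact: cvg_cst|exact: cqf].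
  apply: cvgD; last by apply: cvgM; [exact: cvg_cst|exact: cd0].
  apply: cvgD; last first.
    apply: cvgM; first exact: cvg_cst.
    apply: cvgM; last exact: cvg_cst.
    by apply: cvgM; [exact: cvg_cst|exact: (cvgM cl cl)].
  apply: cvgB; last first.
    by apply: cvgM; [apply: cvgM; [exact: cvg_cst|exact: cl]|exact: cd1].
  apply: cvgB; last exact: cvg_cst.
  exact: (cvgB (cvgB (cvgD s1 s2) s3) s4).
have rr0 : 0 < Order.min r0 r1 by rewrite lt_min r00.
have [|al0] := touching_signs (al := - m * g_z g q1 + k0 * g_z g q0) rr0 _ cK.
  move=> h h0; rewrite lt_min => /andP[hr0 hr1].
  have := hT h hr0; rewrite -subr_le0.
  suff -> : g (c (t0 + h), q1.1.2, q1.2 - m * (h + M / 4 * h ^+ 2))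
     - g (c (t0 + h), q0.1.2, q0.2) =
     h * (- m * g_z g q1 + k0 * g_z g q0) + h ^+ 2 * K h by [].
  rewrite /K /P1 /P2 /P3 /P4 /gzz -/(v h) -/(p0 h) -/(p1 h).
  rewrite (lE h hr0 hr1) d0E // d1E // vE gE -/(om h).
  have := NE h; rewrite uE //.
  exact: touching_algebra.
rewrite xe mulfK // !mulr0 !addr0 !mulr1 -/gzz => kle.
rewrite (mulNr m) in al0; split.
  by move/eqP: al0; rewrite addrC subr_eq0 => /eqP.
by rewrite (mulNr m); exact: touching_reorder kle.
Qed.

End touching.

(** Once the form [qN] is bounded below by a multiple of [m], the whole inequality can be divided by
    [m]; [m <= 1] removes the last [m], in front of [zz], and [Z1 < 0] isolates [M]. *)
Lemma touching_bound (R : realType) (m M D1 D0 Z1 Z0 zz E qN B : R) :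
  0 < m <= 1 -> Z1 < 0 -> Z0 < 0 -> 0 < E ->
  m * Z1 / E * B <= qN ->
  - m * D1 - m * M / 4 * Z1 + 2^-1 * (m ^+ 2 * zz) + m * Z1 / Z0 * D0
    + 2^-1 * qN <= 0 ->
  M <= 4 / - Z1 * (`|D1| + `|zz| + `|Z1 / Z0 * D0| + `|Z1 / E * B|).
Proof.
move=> /andP[m0 m1] Z10 Z00 E0 hB hk.
have hm : m * (- D1 - M / 4 * Z1 + 2^-1 * (m * zz) + Z1 / Z0 * D0
    + 2^-1 * (Z1 / E * B)) <= 0.
  apply: le_trans hk.
  rewrite (_ : m * _ = - m * D1 - m * M / 4 * Z1 + 2^-1 * (m ^+ 2 * zz)
     + m * Z1 / Z0 * D0 + 2^-1 * (m * Z1 / E * B)); last by ring.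
  by rewrite lerD2l ler_pM2l ?invr_gt0.
move: hm; rewrite pmulr_rle0 // => hm.
rewrite mulrAC ler_pdivlMr ?oppr_gt0 //.
have h1 := ler_norm D1; have h3 := ler_norm (- (Z1 / Z0 * D0)).
have h4 := ler_norm (- (Z1 / E * B)).
have h2 : - (m * zz) <= `|zz|.
  apply: (le_trans (ler_norm _)); rewrite normrN normrM gtr0_norm //.
  by rewrite ler_piMl.
have h5 := normr_ge0 zz.
have h6 := normr_ge0 (Z1 / E * B).
rewrite normrN in h3; rewrite normrN in h4.
move: (Z1 / Z0 * D0) (Z1 / E * B) (m * zz) h1 h2 h3 h4 h5 h6 hm.
by clear => a b d h1 h2 h3 h4 h5 h6 hm; nra.
Qed.

(** * Continuity of the determinant and of the inverse matrix *)

Lemma continuous_det (R : realType) (U : normedModType R) (n : nat)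
    (M : U -> 'M[R]_n) (x : U) :
  (forall i j, {for x, continuous (fun t => M t i j)}) ->
  {for x, continuous (fun t => \det (M t))}.
Proof.
move=> cM; rewrite /determinant.
apply: cvg_big => [|s _]; first exact: add_continuous.
apply: cvgM; first exact: cvg_cst.
by apply: cvg_big => [|i _]; [exact: mul_continuous|exact: cM].
Qed.

Lemma continuous_invmx (R : realType) (U : normedModType R) (n : nat)
    (M : U -> 'M[R]_n) (x : U) i j :
  (forall i j, {for x, continuous (fun t => M t i j)}) ->
  M x \in unitmx ->
  {for x, continuous (fun t => invmx (M t) i j)}.
Proof.
move=> cM Mu; have cd := continuous_det cM.
have dx0 : \det (M x) != 0 by rewrite -unitfE -unitmxE.
pose f t := (\det (M t))^-1 * cofactor (M t) j i.
have fE t : \det (M t) != 0 -> invmx (M t) i j = f t.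
  by move=> d0; rewrite /invmx unitmxE unitfE d0 !mxE.
have cf : f t @[t --> x] --> f x.
  apply: cvgM; first exact: cvgV.
  rewrite /cofactor; apply: cvgM; first exact: cvg_cst.
  apply: (@continuous_det _ _ _ (fun t => row' j (col' i (M t)))) => k l.
  have e : (fun t => row' j (col' i (M t)) k l) =
      (fun t => M t (lift j k) (lift i l)) by apply/funext => t; rewrite !mxE.
  suff c : {for x, continuous (fun t => M t (lift j k) (lift i l))}.
    by move: c; rewrite -e.
  exact: cM.
rewrite /prop_for /continuous_at (fE x dx0).
apply: cvg_trans cf; apply: near_eq_cvg.
have : \forall t \near x, \det (M t) != 0.
  have o : nbhs (\det (M x)) [set y : R | y != 0].
    exact: open_nbhs_nbhs.
  exact: cd o.
by apply: filterS => t d0; rewrite fE.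
Qed.

(** * Curves along which Q is affine *)

Section g_segment.
Variables (R : realType) (n : nat) (G : set (xyz R n)) (g : xyz R n -> R).
Hypotheses (hg : generating_function G g) (hA1 : A1 G g) (hA2 : A2 G g).
Hypothesis hA1s : A1star G g.
Hypothesis hA : twice_differentiable_on (U G g) (Amx G g).
Variables (Om : set 'rV[R]_n) (y0 : 'rV[R]_n) (z0 : R).
Hypotheses (oOm : open Om) (hOm : IS G Om y0 z0).

Let F (x : 'rV[R]_n) := Q g (x, y0, z0).

Definition Qjac (x : 'rV[R]_n) : 'M[R]_n :=
  - (g_z g (x, y0, z0))^-1 *: Emx g (x, y0, z0).

Lemma Qjac_unit x : Om x -> Qjac x \in unitmx.
Proof.
move=> Ox; have Gx := hOm Ox.
have uz : - (g_z g (x, y0, z0))^-1 \is a GRing.unit.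
  by rewrite unitfE oppr_eq0 invr_eq0 (g_z_neq0 hg Gx).
by rewrite /Qjac unitmxZ //; exact: (Emx_unit hA2 Gx).
Qed.

Lemma differentiable_lift (y : 'rV[R]_n) (z : R) (x : 'rV[R]_n) :
  differentiable (fun x : 'rV[R]_n => (x, y, z) : xyz R n) x.
Proof. by apply: differentiable_pair => //; apply: differentiable_pair. Qed.

Lemma differentiable_Qx x : Om x -> differentiable F x.
Proof.
move=> Ox; have dl := differentiable_lift y0 z0 x.
exact: (differentiable_comp dl (differentiable_Q hg (hOm Ox))).
Qed.

Lemma derive_Qx x v : Om x -> 'D_v F x = v *m Qjac x.
Proof.
move=> Ox; have Gx := hOm Ox; have dF := differentiable_Qx Ox.
rewrite derive_mx; last exact: diff_derivable.
apply/matrixP => i j; rewrite mxE (ord1 i).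
have [_ e] := derive_Q hg hA1 hA v j Gx.
rewrite /Qjac -scalemxAr -e.
apply: (@derive_comp_affine _ _ _ _ (fun p => Q g p 0 j) (fun t => (t, y0, z0))).
by move=> h; congr (_, _, _); rewrite /= scaler0 addr0.
Qed.

Lemma Q_inj : set_inj Om F.
Proof.
move=> x x'; rewrite !inE => Ox Ox'; apply: (hA1s (y := y0) (z := z0)).
  by rewrite inE; exact: hOm.
by rewrite inE; exact: hOm.
Qed.

Variables (qa D : 'rV[R]_n).

(** The preimage under Q(., y0, z0) of the line through [qa] with direction [D]. The default 0 may
    happen to lie in [Om], so [on_seg] below also records the value of [F]. *)
Definition segQ (t : R) : 'rV[R]_n :=
  xget 0 [set x | Om x /\ F x = qa + t *: D].

Definition on_seg (t : R) : Prop := Om (segQ t) /\ F (segQ t) = qa + t *: D.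

Lemma on_segP t x : Om x -> F x = qa + t *: D -> on_seg t /\ segQ t = x.
Proof.
move=> Ox Fx; rewrite /on_seg /segQ.
case: xgetP => [x' _ [Ox' Fx']|/(_ x) []] //.
by split=> //; apply: Q_inj; rewrite ?inE // Fx.
Qed.

Lemma segQ_near t (r : R) : on_seg t -> 0 < r -> exists2 s : R, 0 < s &
  forall h : R, `|h| < s -> on_seg (t + h) /\ `|segQ (t + h) - segQ t| < r.
Proof.
move=> [Ot Ft] r0.
have hB x : Om x -> Qjac x \in unitmx /\ forall v, 'D_v F x = v *m Qjac x.
  by move=> Ox; split; [exact: Qjac_unit|move=> v; exact: derive_Qx].
have [s s0 hs] := injective_open_map oOm Q_inj differentiable_Qx hB Ot r0.
have D1 : 0 < 1 + `|D| by rewrite ltr_pwDl.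
exists (s / (1 + `|D|)); first by rewrite divr_gt0.
move=> h; rewrite ltr_pdivlMr // => hh.
have [|x [xr Ox Fx]] := hs (qa + (t + h) *: D).
  rewrite Ft; have -> : qa + (t + h) *: D - (qa + t *: D) = h *: D.
    by rewrite scalerDl addrA [X in X - _]addrC addrK.
  rewrite normrZ (le_lt_trans _ hh) //.
  by rewrite ler_wpM2l // lerDr.
by have [ot ->] := on_segP Ox Fx.
Qed.

Lemma segQ_continuous t : on_seg t -> {for t, continuous segQ}.
Proof.
move=> ot; apply/cvgrPdist_le => e e0.
have [s s0 hs] := segQ_near ot e0.
apply/nbhs_ballP; exists s => //= t'; rewrite /ball /= distrC => tt.
have [_ h] := hs (t' - t) tt.
by rewrite subrKC in h; rewrite distrC ltW.
Qed.

Definition segV (t : R) : 'rV[R]_n := D *m invmx (Qjac (segQ t)).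

Lemma segQ_derive t : on_seg t -> is_derive t 1 segQ (segV t).
Proof.
move=> ot; have [Ot Ft] := ot.
have [s s0 hs] := segQ_near ot ltr01.
apply: (@inverse_curve_derive _ _ F (Qjac (segQ t)) segQ D t s) => //.
- exact: differentiable_Qx.
- by move=> v; exact: derive_Qx.
- exact: Qjac_unit.
- exact: segQ_continuous.
by move=> h /hs [[_ ->] _]; rewrite Ft scalerDl addrA.
Qed.

(** Needed for the bound on [M] to be continuous, hence bounded, on [0, 1]. The entries of [Qjac]
    are explicit in derivatives of [g] of order at most two. *)
Lemma segV_continuous t i : on_seg t -> {for t, continuous (fun s => segV s 0 i)}.
Proof.
move=> ot; have [Ot Ft] := ot; have Gt := hOm Ot.
have cl : {for t, continuous (fun s => (segQ s, y0, z0) : xyz R n)}.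
  have := segQ_derive ot => ds.
  have dl := is_derive_lift y0 z0 ds.
  have [d _] := dl.
  by apply: differentiable_continuous; apply/derivable1_diffP.
have comp (f : xyz R n -> R) : {for (segQ t, y0, z0), continuous f} ->
    {for t, continuous (fun s => f (segQ s, y0, z0))}.
  by move=> cf; exact: (continuous_comp cl cf).
have cQ k l : {for t, continuous (fun s => Qjac (segQ s) k l)}.
  pose f q := - (g_z g q)^-1 * ('D_(dy R l) ('D_(dx R k) g) q
        - (g_z g q)^-1 * ('D_(dz R n) ('D_(dx R k) g) q * 'D_(dy R l) g q)).
  have e : (fun s => Qjac (segQ s) k l) = (fun s => f (segQ s, y0, z0)).
    by apply/funext => s; rewrite /Qjac !mxE big_ord1 !mxE.
  rewrite e; apply: (comp f).
  have cz : {for (segQ t, y0, z0), continuous (fun q => (g_z g q)^-1)}.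
    apply: cvgV; first exact: (g_z_neq0 hg Gt).
    exact: (differentiable_continuous (diff_Dg hg _ Gt)).
  have c1 : {for (segQ t, y0, z0), continuous ('D_(dy R l) ('D_(dx R k) g))}.
    exact: (continuous_DDg hg).
  have c2 : {for (segQ t, y0, z0), continuous ('D_(dz R n) ('D_(dx R k) g))}.
    exact: (continuous_DDg hg).
  have c3 : {for (segQ t, y0, z0), continuous ('D_(dy R l) g)}.
    exact: (differentiable_continuous (diff_Dg hg _ Gt)).
  exact: (cvgM (cvgN cz) (cvgB c1 (cvgM cz (cvgM c2 c3)))).
have e : (fun s => segV s 0 i) =
    (fun s => \sum_k D 0 k * invmx (Qjac (segQ s)) k i).
  by apply/funext => s; rewrite mxE.
rewrite e; apply: cvg_sumr => k; apply: cvgM; first exact: cvg_cst.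
apply: (continuous_invmx (M := fun s => Qjac (segQ s))) => //.
exact: Qjac_unit.
Qed.

End g_segment.

(** * The level function *)

Lemma continuous_qf (R : realType) (U : normedModType R) (n : nat)
    (M : U -> 'M[R]_n) (a b : U -> 'rV[R]_n) (x : U) :
  (forall i j, {for x, continuous (fun s => M s i j)}) ->
  (forall i, {for x, continuous (fun s => a s 0 i)}) ->
  (forall i, {for x, continuous (fun s => b s 0 i)}) ->
  {for x, continuous (fun s => qf (M s) (a s) (b s))}.
Proof.
move=> cM ca cb; apply: cvg_sumr => i; apply: cvg_sumr => j.
exact: (cvgM (cM i j) (cvgM (ca i) (cb j))).
Qed.

Lemma continuous_dot (R : realType) (U : normedModType R) (n : nat)
    (a b : U -> 'rV[R]_n) (x : U) :
  (forall i, {for x, continuous (fun s => a s 0 i)}) ->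
  (forall i, {for x, continuous (fun s => b s 0 i)}) ->
  {for x, continuous (fun s => dot (a s) (b s))}.
Proof.
by move=> ca cb; apply: cvg_sumr => i; exact: (cvgM (ca i) (cb i)).
Qed.

Section decreasing.
Variables (R : realType) (n : nat) (G : set (xyz R n)) (g : xyz R n -> R).
Hypothesis hg : generating_function G g.

Lemma g_decr x y (z z' : R) : G (x, y, z) -> G (x, y, z') -> z < z' ->
  g (x, y, z') < g (x, y, z).
Proof.
move=> Gz Gz' zz'.
have GI s : 0 <= s <= z' - z -> G (x, y, z + s).
  move=> /andP[s0 s1]; case: hg => _ /(_ x y) [_ itv] _ _.
  by apply: (itv z z' Gz Gz'); rewrite lerDl s0 -lerBrDl.
have lE (s : R) : (x, y, z + s) = (x, y, z) + s *: dz R n :> xyz R n.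
  by rewrite /dz; congr (_, _, _); rewrite /= ?scaler0 ?addr0 // [s *: _]mulr1.
have d0 : 0 <= z' - z by rewrite subr_ge0 ltW.
have [c c01] := mvt01 d0 (k := fun s => g ((x, y, z) + s *: dz R n))
  (k' := fun s => g_z g ((x, y, z) + s *: dz R n))
  (fun s hs => is_derive_line (@diff_derivable _ _ _ _ _ (dz R n)
     (diff_g hg (eq_ind _ G (GI s hs) _ (lE s))))).
rewrite -!lE addr0 subrKC => e.
rewrite -subr_lt0 e pmulr_llt0 ?subr_gt0 //.
by apply: (g_z_lt0 hg); exact: GI.
Qed.

Lemma g_decr_le x y (z z' : R) : G (x, y, z) -> G (x, y, z') -> z <= z' ->
  g (x, y, z') <= g (x, y, z).
Proof.
by move=> Gz Gz'; rewrite le_eqVlt => /orP[/eqP -> //|/(g_decr Gz Gz') /ltW].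
Qed.

Lemma g_lt_iff x y (z z' : R) : G (x, y, z) -> G (x, y, z') ->
  (g (x, y, z') < g (x, y, z)) = (z < z').
Proof.
move=> Gz Gz'; apply/idP/idP; last exact: g_decr.
by apply: contraTT; rewrite -!leNgt; exact: g_decr_le.
Qed.

Lemma g_le_iff x y (z z' : R) : G (x, y, z) -> G (x, y, z') ->
  (g (x, y, z') <= g (x, y, z)) = (z <= z').
Proof. by move=> Gz Gz'; rewrite leNgt g_lt_iff // -leNgt. Qed.

Lemma gstarP x y u : Jint G g x y u ->
  G (x, y, gstar G g x y u) /\ g (x, y, gstar G g x y u) = u.
Proof. by case=> z Gz gz; rewrite /gstar; case: xgetP => [w _ //|/(_ z) []]. Qed.

Lemma gstar_g x y z : G (x, y, z) -> gstar G g x y (g (x, y, z)) = z.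
Proof.
move=> Gz; have [] := @gstarP x y (g (x, y, z)); first by exists z.
set w := gstar _ _ _ _ _ => Gw gw; apply/eqP; rewrite eq_le.
by rewrite -(g_le_iff Gz Gw) -(g_le_iff Gw Gz) gw lexx.
Qed.

End decreasing.

Section level.
Variables (R : realType) (n : nat) (G : set (xyz R n)) (g : xyz R n -> R).
Hypothesis hg : generating_function G g.
Variables (Om : set 'rV[R]_n) (y0 y1 : 'rV[R]_n) (z0 : R).
Hypotheses (oOm : open Om) (hOm : IS G Om y0 z0).
Hypothesis hJ : forall x, Om x -> Jint G g x y1 (g (x, y0, z0)).

(* The function [g (_, y1, z1)] lies below [g (_, y0, z0)] at [x] exactly when
   [level x < z1]. *)
Definition level (x : 'rV[R]_n) : R := gstar G g x y1 (g (x, y0, z0)).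

Lemma levelP x : Om x -> G (x, y1, level x) /\ g (x, y1, level x) = g (x, y0, z0).
Proof. by move=> /hJ /gstarP. Qed.

Lemma continuous_gx y z x : G (x, y, z) ->
  {for x, continuous (fun x => g (x, y, z))}.
Proof.
move=> Gx; have dl := differentiable_lift y z x.
by apply: differentiable_continuous; exact: (differentiable_comp dl (diff_g hg Gx)).
Qed.

Lemma near_G y z x : G (x, y, z) -> \forall x' \near x, G (x', y, z).
Proof.
move=> Gx; have /differentiable_continuous := differentiable_lift y z x.
by apply; apply: open_nbhs_nbhs; split; [exact: open_G hg|].
Qed.

Lemma near_G_z x y z : G (x, y, z) -> exists2 r : R, 0 < r &
  forall s : R, `|s| < r -> G (x, y, z + s).
Proof.
move=> Gx; have [r r0 hr] := open_norm (open_G hg) Gx.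
exists r => // s hs; apply: hr.
have -> : (x, y, z + s) - (x, y, z) = (0, 0, s) :> xyz R n.
  by congr (_, _, _); rewrite /= ?subrr // addrC addKr.
by rewrite !prod_normE /= !normr0 maxxx max_r.
Qed.

(** Monotonicity in [z] suffices: the strict inequalities at [level x + d] and [level x - d] persist
    near [t] and trap the level. The map [X] is there for the curve [segQ], which is continuous only
    where [on_seg] holds. *)
Lemma level_continuous (T : normedModType R) (X : T -> 'rV[R]_n) (t : T) :
  Om (X t) -> {for t, continuous X} ->
  {for t, continuous (fun s => level (X s))}.
Proof.
set x := X t => Ox cX; have [Gl gl] := levelP Ox; have Gx := hOm Ox.
apply/cvgrPdist_le => e e0.
have [r r0 hr] := near_G_z Gl.
pose d := Order.min e (r / 2).
have d0 : 0 < d by rewrite lt_min e0 divr_gt0.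
have de : d <= e by rewrite /d ge_min lexx.
have dr : d < r by apply: (@le_lt_trans _ _ (r / 2)); [rewrite /d ge_min lexx orbT|lra].
have Gp : G (x, y1, level x + d) by apply: hr; rewrite gtr0_norm.
have Gm : G (x, y1, level x - d) by apply: hr; rewrite normrN gtr0_norm.
have lp : g (x, y1, level x + d) < g (x, y0, z0).
  by rewrite -gl (g_lt_iff hg Gl Gp) ltrDl.
have lm : g (x, y0, z0) < g (x, y1, level x - d).
  by rewrite -gl (g_lt_iff hg Gm Gl) gtrDl oppr_lt0.
have cgX z y : G (x, y, z) -> g (X s, y, z) @[s --> t] --> g (x, y, z).
  by move=> Gz; exact: (continuous_comp cX (continuous_gx Gz)).
have cp : g (X s, y1, level x + d) - g (X s, y0, z0) @[s --> t] -->
    g (x, y1, level x + d) - g (x, y0, z0).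
  exact: (cvgB (cgX _ _ Gp) (cgX _ _ Gx)).
have cm : g (X s, y1, level x - d) - g (X s, y0, z0) @[s --> t] -->
    g (x, y1, level x - d) - g (x, y0, z0).
  exact: (cvgB (cgX _ _ Gm) (cgX _ _ Gx)).
have np : \forall s \near t, g (X s, y1, level x + d) - g (X s, y0, z0) < 0.
  by apply: (cvgr_lt _ cp); rewrite subr_lt0.
have nm : \forall s \near t, 0 < g (X s, y1, level x - d) - g (X s, y0, z0).
  by apply: (cvgr_gt _ cm); rewrite subr_gt0.
have nO : \forall s \near t, Om (X s) by apply: cX; exact: open_nbhs_nbhs.
have nGp : \forall s \near t, G (X s, y1, level x + d) := cX _ (near_G Gp).
have nGm : \forall s \near t, G (X s, y1, level x - d) := cX _ (near_G Gm).
near=> s.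
have Ox' : Om (X s) by near: s.
have [Gl' gl'] := levelP Ox'.
have Gp' : G (X s, y1, level x + d) by near: s.
have Gm' : G (X s, y1, level x - d) by near: s.
have lp' : g (X s, y1, level x + d) - g (X s, y0, z0) < 0 by near: s.
have lm' : 0 < g (X s, y1, level x - d) - g (X s, y0, z0) by near: s.
rewrite -gl' subr_lt0 (g_lt_iff hg Gl' Gp') in lp'.
rewrite -gl' subr_gt0 (g_lt_iff hg Gm' Gl') in lm'.
apply: le_trans de; rewrite ler_norml; apply/andP; split; lra.
Unshelve. all: by end_near. Qed.

End level.

(** * A continuous bound on the curvature parameter of touching curves *)

Section quasiconvex.
Variables (R : realType) (n : nat) (G : set (xyz R n)) (g : xyz R n -> R).
Hypotheses (hg : generating_function G g) (hA1 : A1 G g) (hA2 : A2 G g).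
Hypothesis hA1s : A1star G g.
Hypothesis hA : twice_differentiable_on (U G g) (Amx G g).
Hypothesis hA3w : A3w G g.
Variables (Om : set 'rV[R]_n) (y0 y1 : 'rV[R]_n) (z0 : R).
Hypotheses (oOm : open Om) (hOm : IS G Om y0 z0).
Hypothesis hJ : forall x, Om x -> Jint G g x y1 (g (x, y0, z0)).
Hypothesis y10 : y1 != y0.
Variables (qa D : 'rV[R]_n).

Let lev := level G g y0 y1 z0.
Let c := segQ g Om y0 z0 qa D.
Let xi := segV g Om y0 z0 qa D.
Let ons := on_seg g Om y0 z0 qa D.

Hypothesis hseg : forall x, Om x -> forall t : R, 0 <= t <= 1 ->
  U G g (x, g (x, y0, z0), g_x g (x, y0, z0)
                + t *: (g_x g (x, y1, lev x) - g_x g (x, y0, z0))).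

Let q0 (t : R) : xyz R n := (c t, y0, z0).
Let q1 (t : R) : xyz R n := (c t, y1, lev (c t)).
Let eta t := g_x g (q1 t) - g_x g (q0 t).
(** Derivatives along [xi t] and [eta t] are written out in coordinate directions here and in [N],
    because continuity in [t] is available only for fixed directions. *)
Let Dz (q : xyz R n) (v : 'rV[R]_n) := \sum_i v 0 i * 'D_(dx R i) (g_z g) q.
Let N t : 'M[R]_n := \matrix_(i, j) ('D_(dx R j) ('D_(dx R i) g) (q1 t)
  - 'D_(dx R j) ('D_(dx R i) g) (q0 t)
  - \sum_k eta t 0 k * 'D_(dp R k) (Amx G g) (xup_of g (q0 t)) i j).
Let s t := dot (xi t) (eta t) / dot (eta t) (eta t).
Let B t := qf (N t) (xi t - s t *: eta t) (eta t) + qf (N t) (eta t) (xi t).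

(** The right-hand side of [touching_bound], free of [m] and [M]; a parameter [M] above its maximum
    on [0, 1] admits no touching. *)
Definition convexity_bound t : R := 4 / - g_z g (q1 t) *
  (`|Dz (q1 t) (xi t)| + `|'D_(dz R n) (g_z g) (q1 t)|
   + `|g_z g (q1 t) / g_z g (q0 t) * Dz (q0 t) (xi t)|
   + `|g_z g (q1 t) / dot (eta t) (eta t) * B t|).

Lemma ons_G t : ons t -> [/\ G (q0 t), G (q1 t) & g (q1 t) = g (q0 t)].
Proof.
move=> [Oc _]; have [G1 g1] := levelP hJ Oc.
by split=> //; exact: hOm.
Qed.

(** The values of [g] at the two points agree, so equal gradients would give [y1 = y0] by A1. The
    projection along [eta] and the division by its square rest on this. *)
Lemma eta_neq0 t : ons t -> eta t != 0.
Proof.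
move=> ot; have [G0 G1 e] := ons_G ot.
apply: contra y10; rewrite subr_eq0 => /eqP ge.
have : (y1, lev (c t)) = (y0, z0).
  by apply: (hA1 (x := c t)); rewrite ?inE //= ge e.
by move=> [-> _].
Qed.

Lemma continuous_q0 t : ons t -> {for t, continuous q0}.
Proof.
move=> ot; have cc := segQ_continuous hg hA1 hA2 hA1s hA oOm hOm ot.
exact: (continuous_comp cc (differentiable_continuous (differentiable_lift y0 z0 _))).
Qed.

Lemma continuous_q1 t : ons t -> {for t, continuous q1}.
Proof.
move=> ot; have cc := segQ_continuous hg hA1 hA2 hA1s hA oOm hOm ot.
have cl := level_continuous hg oOm hOm hJ ot.1 cc.
have c1 : {for t, continuous (fun t => (c t, y1) : 'rV[R]_n * 'rV[R]_n)}.
  have cy : {for t, continuous (fun _ : R => y1)} by apply: cst_continuous.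
  exact: (cvg_pair cc cy).
exact: (cvg_pair c1 cl).
Qed.

Lemma convexity_bound_continuous t : ons t ->
  {for t, continuous convexity_bound}.
Proof.
move=> ot; have [G0 G1 e] := ons_G ot.
have c0 := continuous_q0 ot; have c1 := continuous_q1 ot.
have C0 (f : xyz R n -> R) : {for q0 t, continuous f} ->
    {for t, continuous (fun t => f (q0 t))}.
  by move=> cf; exact: (continuous_comp c0 cf).
have C1 (f : xyz R n -> R) : {for q1 t, continuous f} ->
    {for t, continuous (fun t => f (q1 t))}.
  by move=> cf; exact: (continuous_comp c1 cf).
have d0 v : {for t, continuous (fun t => 'D_v g (q0 t))}.
  exact: (C0 _ (differentiable_continuous (diff_Dg hg v G0))).
have d1 v : {for t, continuous (fun t => 'D_v g (q1 t))}.
  exact: (C1 _ (differentiable_continuous (diff_Dg hg v G1))).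
have dd0 v w : {for t, continuous (fun t => 'D_w ('D_v g) (q0 t))}.
  apply: (C0 ('D_w ('D_v g))); exact: (continuous_DDg hg).
have dd1 v w : {for t, continuous (fun t => 'D_w ('D_v g) (q1 t))}.
  apply: (C1 ('D_w ('D_v g))); exact: (continuous_DDg hg).
have cxi i : {for t, continuous (fun t => xi t 0 i)}.
  exact: (segV_continuous hg hA1 hA2 hA1s hA oOm hOm).
have ceta i : {for t, continuous (fun t => eta t 0 i)}.
  have -> : (fun t => eta t 0 i) = fun t => 'D_(dx R i) g (q1 t) - 'D_(dx R i) g (q0 t).
    by apply/funext => r; rewrite !mxE.
  exact: (cvgB (d1 _) (d0 _)).
have cA k i j : {for t, continuous (fun t =>
    'D_(dp R k) (Amx G g) (xup_of g (q0 t)) i j)}.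
  apply: (C0 (fun q => 'D_(dp R k) (Amx G g) (xup_of g q) i j)).
  exact: (continuous_derive_Amx hg hA).
have cN i j : {for t, continuous (fun t => N t i j)}.
  have -> : (fun t => N t i j) = fun t => 'D_(dx R j) ('D_(dx R i) g) (q1 t)
     - 'D_(dx R j) ('D_(dx R i) g) (q0 t)
     - \sum_k eta t 0 k * 'D_(dp R k) (Amx G g) (xup_of g (q0 t)) i j.
    by apply/funext => r; rewrite [LHS]mxE.
  apply: cvgB; first exact: (cvgB (dd1 _ _) (dd0 _ _)).
  by apply: cvg_sumr => k; exact: (cvgM (ceta k) (cA k i j)).
have cE := continuous_dot ceta ceta.
have E0 : dot (eta t) (eta t) != 0 by rewrite gt_eqF // dot_gt0 // eta_neq0.
have cEV : {for t, continuous (fun t => (dot (eta t) (eta t))^-1)}.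
  exact: (cvgV E0 cE).
have cs : {for t, continuous s} by exact: (cvgM (continuous_dot cxi ceta) cEV).
have cxp i : {for t, continuous (fun t => (xi t - s t *: eta t) 0 i)}.
  have -> : (fun t => (xi t - s t *: eta t) 0 i) =
      fun t => xi t 0 i - s t * eta t 0 i.
    apply/funext => r; rewrite [LHS]mxE; congr (_ + _); rewrite [LHS]mxE.
    by congr (- _); rewrite [LHS]mxE.
  exact: (cvgB (cxi i) (cvgM cs (ceta i))).
have cB : {for t, continuous B}.
  exact: (cvgD (continuous_qf cN cxp ceta) (continuous_qf cN ceta cxi)).
have cz1 : {for t, continuous (fun t => g_z g (q1 t))} := d1 _.
have cz0 : {for t, continuous (fun t => (g_z g (q0 t))^-1)}.
  exact: (cvgV (g_z_neq0 hg G0) (d0 _)).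
have cz1n : {for t, continuous (fun t => (- g_z g (q1 t))^-1)}.
  apply: cvgV; first by rewrite oppr_eq0 (g_z_neq0 hg G1).
  exact: (cvgN cz1).
have cD1 : {for t, continuous (fun t => Dz (q1 t) (xi t))}.
  by apply: cvg_sumr => i; exact: (cvgM (cxi i) (dd1 _ _)).
have cD0 : {for t, continuous (fun t => Dz (q0 t) (xi t))}.
  by apply: cvg_sumr => i; exact: (cvgM (cxi i) (dd0 _ _)).
have c4 : {for t, continuous (fun t : R => 4 / - g_z g (q1 t))}.
  by apply: cvgM; [exact: cvg_cst|exact: cz1n].
exact: (cvgM c4 (cvgD (cvgD (cvgD (cvg_norm cD1) (cvg_norm (dd1 _ _)))
  (cvg_norm (cvgM (cvgM cz1 cz0) cD0))) (cvg_norm (cvgM (cvgM cz1 cEV) cB)))).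
Qed.

Lemma touching_le_bound t m M r : ons t -> 0 < m <= 1 -> 0 < r ->
  (forall h : R, `|h| < r ->
     g (c (t + h), y1, lev (c t) - m * (h + M / 4 * h ^+ 2))
       <= g (c (t + h), y0, z0)) ->
  M <= convexity_bound t.
Proof.
move=> ot m01 r0 hT; have [G0 G1 e] := ons_G ot.
have [r1 r10 h1] := segQ_near hg hA1 hA2 hA1s hA oOm hOm ot ltr01.
have dc := segQ_derive hg hA1 hA2 hA1s hA oOm hOm ot.
have rr : 0 < Order.min r r1 by rewrite lt_min r0.
have hQ (h : R) : `|h| < Order.min r r1 ->
    Q g (c (t + h), y0, z0) = Q g (q0 t) + h *: D.
  rewrite lt_min => /andP[_ /h1 [[_ Fh] _]].
  by rewrite Fh; case: ot => _ Ft; rewrite /q0 Ft scalerDl addrA.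
have hT' (h : R) : `|h| < Order.min r r1 ->
    g (c (t + h), (q1 t).1.2, (q1 t).2 - m * (h + M / 4 * h ^+ 2))
      <= g (c (t + h), (q0 t).1.2, (q0 t).2).
  by rewrite lt_min => /andP[/hT].
have [xe hk] := @touching_second_order _ _ G g hg hA1 hA2 hA (q0 t) (q1 t) c t
  _ m M (xi t) D G0 G1 erefl erefl e dc rr hQ hT'.
rewrite -/(eta t) in xe hk.
have DzE q : G q -> 'D_(xi t, 0, 0) (g_z g) q = Dz q (xi t).
  by move=> Gq; rewrite -sum_dx derive_lincomb //; exact: (diff_Dg hg).
rewrite !DzE // xe in hk.
have NE : g_xx g (q1 t) - g_xx g (q0 t)
    - 'D_(0, 0, eta t) (Amx G g) (xup_of g (q0 t)) = N t.
  apply/matrixP => i j; have Uq := U_xup_of g G0.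
  have dA := derive_Amx hA 0 (eta t) i j Uq; rewrite mul0r add0r in dA.
  rewrite [RHS]mxE -dA [LHS]mxE; congr (_ + _); last by rewrite [LHS]mxE.
  rewrite [LHS]mxE; congr (_ + _); first by rewrite mxE.
  by rewrite [LHS]mxE; congr (- _); rewrite mxE.
rewrite NE in hk.
have et0 := eta_neq0 ot.
have No v : dot v (eta t) = 0 -> 0 <= qf (N t) v v.
  move=> vo; rewrite -NE (g_xx_Amx hA1 G1) (g_xx_Amx hA1 G0).
  have -> : xup_of g (q1 t) = (c t, g (q0 t), g_x g (q0 t) + eta t).
    by rewrite /xup_of e /eta subrKC.
  apply: (A3w_segment hg hA1 hA2 hA hA3w) vo => r' hr'.
  exact: (hseg ot.1 hr').
(* The first-order condition: the coefficient of [eta] in [xi] is proportional to [m], so the cross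
   terms survive the division by [m]. *)
have sE : s t = m * g_z g (q1 t) / dot (eta t) (eta t) by rewrite /s xe.
have hB := qf_ortho_ge et0 (erefl (s t)) No.
rewrite -/(B t) {1}sE in hB.
exact: (touching_bound m01 (g_z_lt0 hg G1) (g_z_lt0 hg G0) (dot_gt0 et0) hB hk).
Qed.

End quasiconvex.

(** * A one-dimensional maximum principle *)

(** The square of 1 + y/2 <= exp(y/2); the condition on [y] makes the left side nonnegative. This is
    the origin of the constant 4 in the touching parabola. *)
Lemma expR_ge_quadratic (R : realType) (y : R) : -2 <= y ->
  1 + y + y ^+ 2 / 4 <= expR y.
Proof.
move=> y2; have -> : expR y = expR (y / 2) ^+ 2.
  by rewrite expr2 -expRD -splitr.
have h := expR_ge1Dx (y / 2).
have h0 : 0 <= 1 + y / 2 by lra.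
apply: (@le_trans _ _ ((1 + y / 2) ^+ 2)); last first.
  by rewrite lerXn2r ?nnegrE // ltW // expR_gt0.
by rewrite le_eqVlt; apply/orP; left; apply/eqP; field.
Qed.

(* A maximum of [f + eps * exp (M t)] is a touching point of the parabola of
   the hypothesis, with [m = eps * M * exp (M t)]. *)
Lemma quasiconvex_of_touching (R : realType) (f K : R -> R) :
  (forall t : R, 0 <= t <= 1 -> {for t, continuous f}) ->
  (forall t : R, 0 <= t <= 1 -> {for t, continuous K}) ->
  (forall t m M r : R, 0 <= t <= 1 -> 0 < m <= 1 -> 0 < r ->
     (forall h : R, `|h| < r -> f (t + h) <= f t - m * (h + M / 4 * h ^+ 2)) ->
     M <= K t) ->
  forall t : R, 0 <= t <= 1 -> f t <= Order.max (f 0) (f 1).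
Proof.
move=> cf cK hT t t01; rewrite leNgt; apply/negP => hlt.
have within (u : R -> R) : (forall t : R, 0 <= t <= 1 -> {for t, continuous u}) ->
    {within `[0, 1], continuous u}.
  move=> cu; apply: continuous_in_subspaceT => x; rewrite inE /= in_itv /=.
  exact: cu.
have [tK _ hK] := EVT_max ler01 (within K cK).
pose M := `|K tK| + 1.
have M0 : 0 < M by rewrite ltr_wpDl.
pose d := f t - Order.max (f 0) (f 1).
have d0 : 0 < d by rewrite subr_gt0.
(* The bound [d / 2] prevents the maximum of [W] from lying at an endpoint, and the bound by the
   inverse of [M] ensures [m <= 1]. *)
pose eps := Order.min (d / 2) M^-1 / expR M.
have eps0 : 0 < eps by rewrite divr_gt0 ?expR_gt0 // lt_min divr_gt0 //= invr_gt0.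
have epsd : eps * expR M <= d / 2.
  by rewrite /eps divfK ?gt_eqF ?expR_gt0 // ge_min lexx.
have epsM : eps * expR M <= M^-1.
  by rewrite /eps divfK ?gt_eqF ?expR_gt0 // ge_min lexx orbT.
pose W s := f s + eps * expR (M * s).
have cW (s : R) : 0 <= s <= 1 -> {for s, continuous W}.
  move=> hs; have ce : expR (M * s') @[s' --> s] --> expR (M * s).
    apply: (continuous_comp (f := fun s' => M * s') (g := expR)).
      by apply: cvgM; [exact: cvg_cst|exact: cvg_id].
    exact: continuous_expR.
  apply: cvgD; first exact: cf.
  by apply: cvgM; [exact: cvg_cst|exact: ce].
have [t0 t0i hmax] := EVT_max ler01 (within W cW).
have Wt : f t < W t0.
  apply: (@lt_le_trans _ _ (W t)); first by rewrite ltrDl mulr_gt0 ?expR_gt0.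
  by apply: hmax; rewrite in_itv.
have f0m : f 0 <= Order.max (f 0) (f 1) by rewrite le_max lexx.
have f1m : f 1 <= Order.max (f 0) (f 1) by rewrite le_max lexx orbT.
have e1 : eps <= eps * expR M.
  by rewrite ler_pMr // (le_trans _ (expR_ge1Dx M)) // lerDl ltW.
move: t0i; rewrite in_itv /= => /andP[t00 t01'].
have t0n0 : t0 != 0.
  apply/eqP => t0E; move: Wt; rewrite t0E /W mulr0 expR0 mulr1 /d in epsd *.
  by move: epsd e1 f0m hlt; rewrite /d; lra.
have t0n1 : t0 != 1.
  apply/eqP => t0E; move: Wt; rewrite t0E /W mulr1.
  by move: epsd f1m hlt; rewrite /d; lra.
have t0p : 0 < t0 by rewrite lt_neqAle eq_sym t0n0.
have t0l : t0 < 1 by rewrite lt_neqAle t0n1.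
pose m := eps * M * expR (M * t0).
have m0 : 0 < m := mulr_gt0 (mulr_gt0 eps0 M0) (expR_gt0 _).
have m1 : m <= 1.
  apply: (@le_trans _ _ (eps * expR M * M)); last first.
    by rewrite -ler_pdivlMr // mul1r.
  rewrite /m mulrAC ler_pM2r // ler_pM2l // ler_expR.
  by rewrite ler_piMr // ltW.
(* The first two entries keep [t0 + h] in [0, 1]; the third keeps [M * h] above -2, as
   [expR_ge_quadratic] requires. *)
pose r := Order.min (Order.min t0 (1 - t0)) (2 / M).
have r0 : 0 < r by rewrite !lt_min t0p subr_gt0 t0l divr_gt0.
have MK : M <= K t0.
  apply: (hT t0 m M r) => //; [by rewrite t00 t01'|by rewrite m0 m1|].
  move=> h; rewrite !lt_min ltr_pdivlMr // => /andP[/andP[h1 h2] h3].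
  have hh := ler_norm h; have hh' := ler_norm (- h); rewrite normrN in hh'.
  have : W (t0 + h) <= W t0.
    by apply: hmax; rewrite in_itv /=; apply/andP; split; lra.
  rewrite /W mulrDr expRD => hW.
  have q : 1 + M * h + (M * h) ^+ 2 / 4 <= expR (M * h).
    by apply: expR_ge_quadratic; nra.
  have E0 : 0 < eps * expR (M * t0) := mulr_gt0 eps0 (expR_gt0 _).
  have := q; rewrite -(ler_pM2l E0) => q'.
  have -> : m * (h + M / 4 * h ^+ 2) = eps * expR (M * t0) *
      (1 + M * h + (M * h) ^+ 2 / 4) - eps * expR (M * t0).
    by rewrite /m; field.
  by move: hW q'; rewrite mulrA; lra.
have := hK t0; rewrite in_itv /= t00 t01' => /(_ isT) Kt.
by have := ler_norm (K tK); move: MK Kt; rewrite /M; lra.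
Qed.

(** * Convexity of sections *)

Lemma convex_setP (R : realType) (V : lmodType R) (A : set V) :
  convex_set A <->
  forall x y (t : R), 0 <= t <= 1 -> A x -> A y -> A (y + t *: (x - y)).
Proof.
have cE (x y : V) (t : R) : t *: x + (1 - t) *: y = y + t *: (x - y).
  by rewrite scalerBl scale1r scalerBr addrCA.
split=> [cA x y t /andP[t0 t1] Ax Ay|cA x y l].
  have := cA x y (Itv01 t0 t1); rewrite !inE => /(_ Ax Ay).
  by rewrite -cE.
rewrite !inE => Ax Ay.
have -> : conv l x y = y + l%:num *: (x - y) by rewrite -cE.
by apply: cA => //; apply/andP; split.
Qed.

Section sections.
Variables (R : realType) (n : nat) (G : set (xyz R n)) (g : xyz R n -> R).
Hypotheses (hg : generating_function G g) (hA1 : A1 G g) (hA2 : A2 G g).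
Hypothesis hA1s : A1star G g.
Hypothesis hA : twice_differentiable_on (U G g) (Amx G g).
Hypothesis hA3w : A3w G g.
Variables (Om : set 'rV[R]_n) (y0 : 'rV[R]_n) (z0 : R).
Hypothesis oOm : open Om.
Hypothesis hi : g_convex_set G g Om y0 z0.

Let hOm : IS G Om y0 z0 := hi.1.

Lemma on_seg_all x x' : Om x -> Om x' -> forall t : R, 0 <= t <= 1 ->
  on_seg g Om y0 z0 (Q g (x', y0, z0))
    (Q g (x, y0, z0) - Q g (x', y0, z0)) t.
Proof.
move=> Ox Ox' t t01.
have [] := (convex_setP _).1 hi.2 (Q g (x, y0, z0)) (Q g (x', y0, z0)) t t01.
- by exists x.
- by exists x'.
by move=> w Ow Fw; have [] := on_segP hA1s hOm Ow Fw.
Qed.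

Lemma level_quasiconvex y1 x x' x'' (t : R) :
  (forall x, Om x -> sub_gstar_convex_at G g [set y0; y1] x (g (x, y0, z0))) ->
  Om x -> Om x' -> Om x'' -> 0 <= t <= 1 ->
  Q g (x'', y0, z0) = Q g (x', y0, z0) + t *: (Q g (x, y0, z0) - Q g (x', y0, z0)) ->
  level G g y0 y1 z0 x'' <= Order.max (level G g y0 y1 z0 x') (level G g y0 y1 z0 x).
Proof.
move=> hc Ox Ox' Ox'' t01 Fx''.
(* For [y1 = y0] the level is the constant [z0]. *)
have [->|y10] := eqVneq y1 y0.
  by rewrite /level !(gstar_g hg) ?maxxx //; exact: hOm.
have hJ w : Om w -> Jint G g w y1 (g (w, y0, z0)).
  by move=> /hc [h _]; apply: h; right.
set lev := level G g y0 y1 z0.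
have hseg w : Om w -> forall t : R, 0 <= t <= 1 ->
    U G g (w, g (w, y0, z0), g_x g (w, y0, z0)
                + t *: (g_x g (w, y1, lev w) - g_x g (w, y0, z0))).
  move=> Ow r r01; have [_ hull] := hc w Ow.
  have P0 : P G g w y0 (g (w, y0, z0)) = g_x g (w, y0, z0).
    by rewrite /P (gstar_g hg) //; exact: hOm.
  (* The segment joining the two gradients lies in the convex hull, so sub g*-convexity realises
     each of its points by some [y] at the same value of [g], which is membership in [U]. *)
  have [|y Gy <-] := hull (g_x g (w, y0, z0)
                + r *: (g_x g (w, y1, lev w) - g_x g (w, y0, z0))).
    move=> C [cC sC]; apply: (convex_setP C).1 => //; apply: sC.
      by exists y1 => //; right.
    by exists y0; [left|].
  have [Gg gg] := gstarP Gy.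
  by exists y, (gstar G g w y (g (w, y0, z0))).
set qa := Q g (x', y0, z0) in Fx'' *; set D := Q g (x, y0, z0) - qa in Fx''.
pose c := segQ g Om y0 z0 qa D.
have ons := on_seg_all Ox Ox'; rewrite -/qa -/D in ons.
have cE s w : Om w -> Q g (w, y0, z0) = qa + s *: D -> c s = w.
  by move=> Ow Fw; have [] := on_segP hA1s hOm Ow Fw.
have c1 : c 1 = x by apply: cE; rewrite ?scale1r ?subrKC.
have c0 : c 0 = x' by apply: cE; rewrite ?scale0r ?addr0.
rewrite -(cE t x'' Ox'' Fx'') -c1 -c0.
apply: (@quasiconvex_of_touching _ (fun s => lev (c s))
  (convexity_bound G g Om y0 y1 z0 qa D)) t01.
- move=> s s01; apply: (level_continuous hg oOm hOm hJ); first by have [] := ons s s01.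
  exact: (segQ_continuous hg hA1 hA2 hA1s hA oOm hOm (ons s s01)).
- move=> s s01.
  exact: (convexity_bound_continuous hg hA1 hA2 hA1s hA oOm hOm hJ y10 (ons s s01)).
move=> s m M r s01 m01 r0 hf.
have os := ons s s01.
have [r1 r10 hr1] := segQ_near hg hA1 hA2 hA1s hA oOm hOm os ltr01.
(* The inequality between levels becomes one between values of [g] only while the parabola stays
   inside [G]; [r2] guarantees this. *)
pose p h : xyz R n := (c (s + h), y1, lev (c s) - m * (h + M / 4 * h ^+ 2)).
have [r2 r20 hr2] : exists2 r2 : R, 0 < r2 & forall h : R, `|h| < r2 -> G (p h).
  have [Gl _] := levelP hJ os.1.
  have [ra ra0 ha] := open_norm (open_G hg) Gl.
  have [rb rb0 hb] := segQ_near hg hA1 hA2 hA1s hA oOm hOm os ra0.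
  set A := `|m| * (1 + `|M|) + 1.
  have A0 : 0 < A by rewrite ltr_wpDl // mulr_ge0 // addr_ge0.
  exists (Order.min (Order.min rb 1) (ra / A)).
    by rewrite !lt_min rb0 ltr01 divr_gt0.
  move=> h; rewrite !lt_min ltr_pdivlMr // => /andP[/andP[/hb [_ hc'] h1] h2].
  apply: ha; rewrite !prod_normE /= subrr normr0 !gt_max hc' ra0 /=.
  rewrite addrAC subrr add0r normrN (le_lt_trans (parabola_le m M h1)) //.
  by rewrite mulrC.
apply: (touching_le_bound hg hA1 hA2 hA1s hA hA3w oOm hOm hJ y10 hseg os m01
  (r := Order.min r (Order.min r1 r2))).
  by rewrite !lt_min r0 r10.
move=> h; rewrite !lt_min => /and3P[/hf hfr /hr1 [[Oc _] _] /hr2 Gp].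
have [Gl gl] := levelP hJ Oc.
by rewrite -gl; exact: (g_decr_le hg).
Qed.

(** The relation [C] stands for [<] or [<=], so that one argument covers the section and the contact
    set. *)
Lemma section_convex (u : 'rV[R]_n -> R) (C : R -> R -> bool)
    (hgu : g_convex_function G g Om u)
    (hii : sub_gstar_convex G g
             ((\bigcup_(x in Om) Tu G g Om u x) `|` [set y0])
             (fun x => g (x, y0, z0)) Om)
    (hC : forall a b c, a <= b -> C b c -> C a c)
    (hCg : forall x y z z', G (x, y, z) -> G (x, y, z') ->
      C (g (x, y, z')) (g (x, y, z)) = C z z')
    (hCm : forall a b c, C (Order.max a b) c = C a c && C b c) :
  g_convex_set G g [set x | Om x /\ C (u x) (g (x, y0, z0))] y0 z0.
Proof.
split; first by move=> x [Ox _]; exact: hOm.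
apply/convex_setP => _ _ t t01 [x [Ox ux] <-] [x' [Ox' ux'] <-].
have [] := (convex_setP _).1 hi.2 (Q g (x, y0, z0)) (Q g (x', y0, z0)) t t01.
- by exists x.
- by exists x'.
move=> x'' Ox'' Fx''; exists x'' => //; split=> //.
(* A single support, at the intermediate point, is enough: it equals [u] there and lies below [u] at
   the two ends. *)
have [y1 [z1 [Gy1 u1 gu]]] := hgu x'' Ox''.
have y1T : ((\bigcup_(x in Om) Tu G g Om u x) `|` [set y0]) y1.
  left; exists x'' => //; have G1 := Gy1 x'' Ox''.
  split; first by exists z1.
  by rewrite u1 (gstar_g hg G1).
(* Sub g*-convexity passes to a subset: the hull shrinks, while the set that must contain it stays
   the same. *)
have hc w : Om w -> sub_gstar_convex_at G g [set y0; y1] w (g (w, y0, z0)).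
  move=> Ow; have [h1 h2] := hii w Ow.
  have sub : [set y0; y1] `<=`
      (\bigcup_(x in Om) Tu G g Om u x) `|` [set y0].
    by move=> y [->|->] //; right.
  split; first by move=> y /sub; exact: h1.
  move=> v hv; apply: h2 => K [cK sK]; apply: hv; split=> //.
  by move=> _ [y /sub Sy <-]; apply: sK; exists y.
have hJ w : Om w -> Jint G g w y1 (g (w, y0, z0)).
  by move=> /hc [h _]; apply: h; right.
have lvl w : Om w -> C (g (w, y1, z1)) (g (w, y0, z0)) = C (level G g y0 y1 z0 w) z1.
  by move=> Ow; have [Gl <-] := levelP hJ Ow; rewrite hCg //; exact: Gy1.
rewrite u1 lvl //.
apply: (hC _ _ _ (level_quasiconvex hc Ox Ox' Ox'' t01 Fx'')).
rewrite hCm -!lvl //.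
by rewrite (hC _ _ _ (gu x' Ox') ux') (hC _ _ _ (gu x Ox) ux).
Qed.

End sections.

Unset Implicit Arguments.

Theorem lemma2p3 (R : realType) (n : nat)
    (G : set ('rV[R]_n * 'rV[R]_n * R)) (g : 'rV[R]_n * 'rV[R]_n * R -> R)
    (Om : set 'rV[R]_n) (u : 'rV[R]_n -> R) (y0 : 'rV[R]_n) (z0 : R)
    (hg : generating_function G g)
    (hA1 : A1 G g) (hA2 : A2 G g) (hA1star : A1star G g)
    (hA : twice_differentiable_on (U G g) (Amx G g)) (hA3w : A3w G g)
    (hOm : is_domain Om) (hOmb : bounded_set Om)
    (hu : {within Om, continuous u}) (hgu : g_convex_function G g Om u)
    (hi : g_convex_set G g Om y0 z0)
    (hii : sub_gstar_convex G g
             ((\bigcup_(x in Om) Tu G g Om u x) `|` [set y0])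
             (fun x => g (x, y0, z0)) Om) :
  g_convex_set G g [set x | Om x /\ u x < g (x, y0, z0)] y0 z0 /\
  (g_support G g Om u y0 z0 ->
   g_convex_set G g [set x | Om x /\ u x = g (x, y0, z0)] y0 z0).
Proof.
have [_ oOm _] := hOm.
split.
  apply: (section_convex hg hA1 hA2 hA1star hA hA3w oOm hi
    (C := fun a b => a < b) hgu hii) => [a b c|x y z z' Gz Gz'|a b c].
  - exact: le_lt_trans.
  - exact: (g_lt_iff hg).
  - by rewrite gt_max.
move=> [x0 _ [_ _ gu]].
(* Equality alone does not satisfy the monotonicity asked of [C]; since a support lies below [u], it
   can be replaced by [<=]. *)
have -> : [set x | Om x /\ u x = g (x, y0, z0)] =
    [set x | Om x /\ u x <= g (x, y0, z0)].
  apply/seteqP; split=> x /= [Ox h]; split=> //; first by rewrite h.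
  by apply/eqP; rewrite eq_le h gu.
apply: (section_convex hg hA1 hA2 hA1star hA hA3w oOm hi
  (C := fun a b => a <= b) hgu hii) => [a b c|x y z z' Gz Gz'|a b c].
- exact: le_trans.
- exact: (g_le_iff hg).
- by rewrite ge_max.
Qed.
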